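(* Let $R$ be a Cohen-Macaulay local ring with canonical module $\omega$. Then the following statements are equivalent: (i) $R$ is Gorenstein; (ii) $\Omega_n^R(\omega)$ has a non-zero free direct summand for some $n \ge 0$.
   Context: All rings are commutative Noetherian local rings and all modules are finitely generated. For an $R$-module $M$ and $n \ge 0$, $\Omega_n^R(M)$ denotes the $n$th syzygy module of $M$, i.e. the image of the $n$th differential of an augmented minimal free resolution of $M$ (so $\Omega_0^R(M) = M$); it is unique up to isomorphism. A canonical module of a $d$-dimensional Cohen-Macaulay local ring $(R,\mathfrak{m},k)$ is an $R$-module $\omega$ such that $\mathrm{rank}_k(\mathrm{Ext}_R^i(k,\omega)) = \delta_{id}$ for all $i$. *)

(* Defs.v *)
From HB Require Import structures.
From mathcomp Require Import all_boot all_order all_algebra.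
From mathcomp Require Import generic_quotient ring_quotient.
From mathcomp Require Import boolp classical_sets functions.

Set Implicit Arguments.
Unset Strict Implicit.
Unset Printing Implicit Defensive.

Import GRing.Theory.
Local Open Scope ring_scope.
Local Open Scope quotient_scope.

(* Submodules of V are terms of the library type submodClosed V, proper ideals
   of R are terms of idealr R and prime ideals are terms of prime_idealr R.
   These are boolean predicates; as classical logic is assumed, this is no
   restriction. *)

Section SubModule.
Context {R : comNzRingType} {V : lmodType R} (S : submodClosed V).

Record submod_of := SubmodOf { submod_val : V; _ : submod_val \in S }.

HB.instance Definition _ := [isSub for submod_val].
HB.instance Definition _ := [Choice of submod_of by <:].
HB.instance Definition _ := [SubChoice_isSubLmodule of submod_of by <:].

End SubModule.

Section QuotientModule.
Context {R : comNzRingType} {V : lmodType R} (S : submodClosed V).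

(* The library only knows terms of submodClosed V as submodules over a
   semiring; closure under opposites has to be derived. *)
Definition submod_zmod : {pred V} := S.

Lemma submod_zmod_closed : zmod_closed submod_zmod.
Proof. exact: GRing.submod_closedB (submodClosedP S). Qed.

HB.instance Definition _ := GRing.isZmodClosed.Build V submod_zmod
  submod_zmod_closed.

Definition quotmod := Quotient.quot submod_zmod.

HB.instance Definition _ := GRing.Zmodule.on quotmod.

Definition quotmod_pi (x : V) : quotmod := \pi_(Quotient.quot submod_zmod) x.

Definition quotmod_scale (a : R) (x : quotmod) : quotmod :=
  quotmod_pi (a *: repr (x : Quotient.quot submod_zmod)).

Lemma quotmod_pi_surj (y : quotmod) : exists x, quotmod_pi x = y.
Proof. by exists (repr (y : Quotient.quot submod_zmod)); apply: reprK. Qed.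

Lemma quotmodP (x y : V) : quotmod_pi x = quotmod_pi y <-> x - y \in S.
Proof.
rewrite -[x - y \in S]/(x - y \in submod_zmod) Quotient.idealrBE.
by split=> [?|/eqP]; first apply/eqP.
Qed.

Lemma quotmod_piD : {morph quotmod_pi : x y / x + y}.
Proof. exact: Quotient.pi_add. Qed.

Lemma quotmod_piZ (a : R) (x : V) :
  quotmod_pi (a *: x) = quotmod_scale a (quotmod_pi x).
Proof.
apply: (iffRL (quotmodP _ _)); rewrite -scalerBr rpredZ //.
exact: (iffLR (quotmodP _ _) (esym (reprK (quotmod_pi x)))).
Qed.

Lemma quotmod_scaleA a b x :
  quotmod_scale a (quotmod_scale b x) = quotmod_scale (a * b) x.
Proof.
by have [y <-] := quotmod_pi_surj x; rewrite -!quotmod_piZ scalerA.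
Qed.

Lemma quotmod_scale1 : left_id 1 quotmod_scale.
Proof.
by move=> x; have [y <-] := quotmod_pi_surj x; rewrite -quotmod_piZ scale1r.
Qed.

Lemma quotmod_scaleDr : right_distributive quotmod_scale +%R.
Proof.
move=> a x y; have [u <-] := quotmod_pi_surj x.
have [v <-] := quotmod_pi_surj y.
by rewrite -quotmod_piD -!quotmod_piZ scalerDr quotmod_piD.
Qed.

Lemma quotmod_scaleDl x : {morph quotmod_scale^~ x : a b / a + b}.
Proof.
move=> a b; have [u <-] := quotmod_pi_surj x.
by rewrite -!quotmod_piZ scalerDl quotmod_piD.
Qed.

HB.instance Definition _ := GRing.Zmodule_isLmodule.Build R quotmod
  quotmod_scaleA quotmod_scale1 quotmod_scaleDr quotmod_scaleDl.

Lemma quotmod_pi_linear : linear quotmod_pi.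
Proof. by move=> a x y; rewrite quotmod_piD quotmod_piZ. Qed.

HB.instance Definition _ :=
  GRing.isLinear.Build R V quotmod *:%R quotmod_pi quotmod_pi_linear.

End QuotientModule.

Section SubQuotient.
Context {R : comNzRingType} {V : lmodType R} (Z B : submodClosed V).

Definition submod_trace : {pred submod_of Z} := fun z => val z \in B.

Lemma submod_trace_closed : submod_closed submod_trace.
Proof.
split=> [|a x y xB yB]; first exact: (rpred0 B).
have -> : (a *: x + y \in submod_trace) = (a *: val x + val y \in B) by [].
by rewrite rpredD // rpredZ.
Qed.

HB.instance Definition _ :=
  GRing.isSubmodClosed.Build R (submod_of Z) submod_trace submod_trace_closed.

(* Z / (Z :&: B), used when B is contained in Z *)
Definition subquotient : lmodType R := quotmod submod_trace.

End SubQuotient.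

Section Image.
Context {R : comNzRingType} {U V : lmodType R} (f : {linear U -> V}).

Definition image_pred : {pred V} := fun y => `[< exists x, f x = y >].

Lemma image_pred_closed : submod_closed image_pred.
Proof.
split=> [|a x y]; first by apply/asboolP; exists 0; rewrite linear0.
move=> /asboolP[u <-] /asboolP[v <-]; apply/asboolP.
by exists (a *: u + v); rewrite linearP.
Qed.

HB.instance Definition _ :=
  GRing.isSubmodClosed.Build R V image_pred image_pred_closed.

Definition image_mod : lmodType R := submod_of image_pred.

End Image.

Definition fin_gen {R : comNzRingType} (M : lmodType R) : Prop :=
  exists (n : nat) (g : 'I_n -> M),
    forall x, exists a : 'I_n -> R, x = \sum_i a i *: g i.

Definition noetherian (R : comNzRingType) : Prop :=
  forall I : submodClosed R^o, fin_gen (submod_of I).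

Definition maximal_ideal {R : comNzRingType} (m : idealr R) : Prop :=
  forall J : idealr R, {subset m <= J} -> J =i m.

Definition local_ring {R : comNzRingType} (m : idealr R) : Prop :=
  maximal_ideal m /\ forall m' : idealr R, maximal_ideal m' -> m' =i m.

Definition prime_chain (R : comNzRingType) (n : nat) : Prop :=
  exists p : 'I_n.+1 -> prime_idealr R,
    forall i j : 'I_n.+1, (i < j)%N ->
      {subset p i <= p j} /\ ~ {subset p j <= p i}.

Definition krull_dim (R : comNzRingType) (d : nat) : Prop :=
  prime_chain R d /\ forall n, prime_chain R n -> (n <= d)%N.

Definition in_ideal_gen {R : comNzRingType} (s : seq R) (y : R) : Prop :=
  exists c : 'I_(size s) -> R, y = \sum_i c i * s`_i.

Definition regular_seq {R : comNzRingType} (s : seq R) : Prop :=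
  (forall i, (i < size s)%N -> forall a,
     in_ideal_gen (take i s) (s`_i * a) -> in_ideal_gen (take i s) a)
  /\ ~ in_ideal_gen s 1.

Definition depth {R : comNzRingType} (m : idealr R) (d : nat) : Prop :=
  (exists s : seq R, [/\ size s = d, {subset s <= m} & regular_seq s])
  /\ forall s : seq R, {subset s <= m} -> regular_seq s -> (size s <= d)%N.

Definition cohen_macaulay {R : comNzRingType} (m : idealr R) : Prop :=
  exists d, krull_dim R d /\ depth m d.

Record free_resolution {R : comNzRingType} (M : lmodType R) := FreeResolution {
  res_rank : nat -> nat;
  res_aug : {linear 'rV[R]_(res_rank 0) -> M};
  res_diff : forall n,
    {linear 'rV[R]_(res_rank n.+1) -> 'rV[R]_(res_rank n)};
  res_surj : forall y, exists x, res_aug x = y;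
  res_exact0 : forall x, res_aug x = 0 <-> exists y, res_diff 0%N y = x;
  res_exactS : forall n x,
    res_diff n x = 0 <-> exists y, res_diff n.+1 y = x
}.

(* The image of every differential is contained in m F_n. *)
Definition minimal_resolution {R : comNzRingType} (m : idealr R)
    (M : lmodType R) (F : free_resolution M) : Prop :=
  forall n x j, res_diff F n x 0 j \in m.

(* In the augmented complex the differentials are numbered with the
   augmentation as the 0th, so res_diff F n is the (n+1)st. *)
Definition syzygy {R : comNzRingType} {M : lmodType R}
    (F : free_resolution M) (n : nat) : lmodType R :=
  if n is n'.+1 then image_mod (res_diff F n') else M.

Definition has_nonzero_free_summand {R : comNzRingType} (M : lmodType R)
    : Prop :=
  exists (r : nat) (X : lmodType R)
         (phi : {linear M -> ('rV[R]_r * X)%type}),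
    (0 < r)%N /\ bijective phi.

Lemma linear_fun0 (R : comNzRingType) (U V : lmodType R) :
  linear (0 : U -> V).
Proof. by move=> b u v; change (0 = b *: 0 + 0 :> V); rewrite scaler0 addr0. Qed.

Lemma linear_funP (R : comNzRingType) (U V : lmodType R) a (f g : U -> V) :
  linear f -> linear g -> linear (a *: f + g).
Proof.
move=> fL gL b u v; rewrite !fctE fL gL !scalerDr !scalerA [b * a]mulrC.
by rewrite addrACA.
Qed.

Section Ext.
Context {R : comNzRingType} {M : lmodType R} (F : free_resolution M).
Context (N : lmodType R).

Definition cocycle (i : nat) : {pred 'rV[R]_(res_rank F i) -> N} :=
  fun f => `[< linear f /\ forall x, f (res_diff F i x) = 0 >].

Definition coboundary (i : nat) : {pred 'rV[R]_(res_rank F i) -> N} :=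
  match i return {pred 'rV[R]_(res_rank F i) -> N} with
  | 0 => fun f => `[< f = 0 >]
  | j.+1 => fun f => `[< exists g : 'rV[R]_(res_rank F j) -> N,
                           linear g /\ f = g \o res_diff F j >]
  end.

Arguments cocycle i : clear implicits.
Arguments coboundary i : clear implicits.

Lemma cocycle_closed i : submod_closed (cocycle i).
Proof.
split=> [|a f g /asboolP[fL fd] /asboolP[gL gd]]; apply/asboolP.
  by split=> [|x //]; apply: linear_fun0.
split=> [|x]; first exact: linear_funP.
by rewrite !fctE fd gd scaler0 addr0.
Qed.

HB.instance Definition _ i := GRing.isSubmodClosed.Build R
  ('rV[R]_(res_rank F i) -> N) (cocycle i) (cocycle_closed i).

Lemma coboundary_closed i : submod_closed (coboundary i).
Proof.
case: i => [|i].
  split=> [|a f g /asboolP-> /asboolP->]; apply/asboolP => //.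
  by rewrite scaler0 addr0.
split=> [|a f g /asboolP[f' [fL ->]] /asboolP[g' [gL ->]]]; apply/asboolP.
  by exists 0; split=> //; apply: linear_fun0.
by exists (a *: f' + g'); split=> //; apply: linear_funP.
Qed.

HB.instance Definition _ i := GRing.isSubmodClosed.Build R
  ('rV[R]_(res_rank F i) -> N) (coboundary i) (coboundary_closed i).

(* Ext^i_R(M, N) = H^i(Hom_R(F, N)) for the free resolution F of M *)
Definition Ext (i : nat) : lmodType R := subquotient (cocycle i) (coboundary i).

End Ext.

Section ResidueField.
Context {R : comNzRingType} (m : idealr R).

Definition ideal_submod : {pred R^o} := fun x => x \in (m : {pred R}).

Lemma ideal_submod_closed : submod_closed ideal_submod.
Proof.
split=> [|a x y xm ym]; first exact: (idealr0 m).
exact: (rpredD (idealMr a xm) ym).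
Qed.

HB.instance Definition _ :=
  GRing.isSubmodClosed.Build R R^o ideal_submod ideal_submod_closed.

Definition residue_field : lmodType R := quotmod ideal_submod.

(* E is a vector space of dimension r over k = R / m: it is killed by m, and e
   is a k-basis, scalars in k being represented by elements of R. *)
Definition residue_rank (E : lmodType R) (r : nat) : Prop :=
  (forall (a : R) (x : E), a \in m -> a *: x = 0) /\
  exists e : 'I_r -> E,
    (forall x, exists a : 'I_r -> R, x = \sum_i a i *: e i) /\
    (forall a : 'I_r -> R, \sum_i a i *: e i = 0 -> forall i, a i \in m).

Definition canonical_module (omega : lmodType R) : Prop :=
  fin_gen omega /\
  exists d, krull_dim R d /\
    exists P : free_resolution residue_field,
      forall i, residue_rank (Ext P omega i) (i == d).

End ResidueField.

Definition injective_module {R : comNzRingType} (E : lmodType R) : Prop :=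
  forall (A B : lmodType R) (j : {linear A -> B}) (f : {linear A -> E}),
    injective j -> exists g : {linear B -> E}, forall x, g (j x) = f x.

Definition finite_injective_dimension {R : comNzRingType} (M : lmodType R)
    : Prop :=
  exists (n : nat) (E : nat -> lmodType R) (eta : {linear M -> E 0%N})
         (delta : forall i, {linear E i -> E i.+1}),
    [/\ forall i, injective_module (E i),
        injective eta,
        forall y, delta 0%N y = 0 <-> exists x, eta x = y,
        forall i y, delta i.+1 y = 0 <-> exists x, delta i x = y
      & forall i, (n < i)%N -> forall x : E i, x = 0].

Definition gorenstein (R : comNzRingType) : Prop :=
  finite_injective_dimension (R^o : lmodType R).

(* Main.v *)
From HB Require Import structures.
Require Import Defs.
From mathcomp Require Import all_boot all_order all_algebra.
From mathcomp Require Import ring_quotient.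
From mathcomp Require Import boolp classical_sets functions.

Set Implicit Arguments.
Unset Strict Implicit.
Unset Printing Implicit Defensive.

Import GRing.Theory.
Local Open Scope ring_scope.

(** Write d for dim R = depth R, k for R/m, and H_i(N) for Ext^i(k, N), computed
    from the given free resolution P of k. The canonical module omega has
    H_d(omega) of dimension one over k and all other H_i(omega) zero, while
    H_i(R) = 0 for i < d and H_d(R) <> 0 because R has depth d.

    From (ii) to (i). If R is a direct summand of omega, then H_i(R) is a direct
    summand of H_i(omega), so it vanishes for i > d. This makes the injective
    dimension of R at most d (bass, cosyz_injective): the vanishing propagates
    from k to all R/I by Noetherian induction and Nakayama's lemma, and Baer's
    criterion concludes. If R is a direct summand of a later syzygy
    Omega_(n+1), which lies in m F_n, then R -> Omega_(n+1) -> F_n induces zero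
    on H_d because H_d is killed by m. But H_d(Omega_(n+1)) -> H_d(F_n) is
    injective, as H_(d-1)(Omega_n) = 0. Hence H_d(R) = 0, a contradiction
    (no_free_summand).

    From (i) to (ii). Here omega itself is shown to be free of rank one
    (canonical_free), so n = 0 will do. Choose a sequence t of length d that is
    regular on R and on omega; it exists because H_i(R) and H_i(omega) vanish
    for i < d (regular_element, regular_exists). Both R and omega have injective
    dimension at most d: for omega this is the argument above, and for R the
    finite injective dimension that is given can be lowered to d, as k embeds in
    R/(t), a module of projective dimension d (injective_dimension_depth).
    Therefore R/(t) and omega/t omega are injective relative to ideals that
    contain (t) (injective_modulo_regular). Their socles are essential
    (socle_essential), and that of omega/t omega is a line because H_d(omega)
    is. A map R/(t) -> omega/t omega that carries a socle element to a socle
    element is then injective (kernel_modulo) and surjective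
    (generator_modulo), and it lifts to an isomorphism R -> omega
    (generator_lift, kernel_lift).

    Injective resolutions enter as chains of short exact sequences
    0 -> C_j -> I_j -> C_(j+1) -> 0, so that Ext^(j+1)(A, C_0) is the group of
    maps A -> C_(j+1) modulo those that lift to I_j. Such chains exist because
    every module embeds into a product of copies of Hom_Z(R, Q/Z). *)

(** * Submodules and linear maps *)

Section Submodules.
Context {R : comNzRingType}.
Implicit Types U V W : lmodType R.

Definition submodule V (S : V -> Prop) :=
  S 0 /\ forall a x y, S x -> S y -> S (a *: x + y).

Lemma sub0 V (S : V -> Prop) : submodule S -> S 0.
Proof. by case. Qed.

Lemma subD V (S : V -> Prop) x y : submodule S -> S x -> S y -> S (x + y).
Proof. by move=> [_ h] Sx Sy; have := h 1 _ _ Sx Sy; rewrite scale1r. Qed.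

Lemma subZ V (S : V -> Prop) a x : submodule S -> S x -> S (a *: x).
Proof. by move=> [h0 h] Sx; have := h a _ _ Sx h0; rewrite addr0. Qed.

Lemma subN V (S : V -> Prop) x : submodule S -> S x -> S (- x).
Proof. by move=> hS Sx; rewrite -scaleN1r; apply: subZ. Qed.

Lemma subB V (S : V -> Prop) x y : submodule S -> S x -> S y -> S (x - y).
Proof. by move=> hS Sx Sy; apply: subD => //; apply: subN. Qed.

Lemma quotmod_eq0 V (S : submodClosed V) x : quotmod_pi S x = 0 <-> x \in S.
Proof.
rewrite -(linear0 (quotmod_pi S)); split=> [/quotmodP|h]; last apply/quotmodP.
all: by rewrite subr0.
Qed.

Section Bundle.
Context V (S : V -> Prop) (hS : submodule S).

Let SP : {pred V} := fun x => `[< S x >].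

Lemma submodule_closed : submod_closed SP.
Proof.
split=> [|a x y /asboolP Sx /asboolP Sy]; apply/asboolP; first by case: hS.
by case: hS => _; apply.
Qed.

Definition bundle : submodClosed V :=
  HB.pack_for (submodClosed V) SP
    (GRing.isSubmodClosed.Build R V SP submodule_closed).

Lemma bundleP x : (x \in bundle) <-> S x.
Proof. by split=> [/asboolP|h]; last apply/asboolP. Qed.

End Bundle.

Lemma bundle_linear U V (f : U -> V) : linear f -> exists g : {linear U -> V}, g =1 f.
Proof.
move=> fL.
by exists (HB.pack_for {linear U -> V} f (GRing.isLinear.Build R U V *:%R f fL)).
Qed.

Lemma pair_subr U V (u u' : U) (v v' : V) :
  (u, v) - (u', v') = (u - u', v - v') :> (U * V)%type.
Proof. by []. Qed.

Lemma pair_addr U V (u u' : U) (v v' : V) :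
  (u, v) + (u', v') = (u + u', v + v') :> (U * V)%type.
Proof. by []. Qed.

Lemma pair_scaler U V (a : R) (u : U) (v : V) :
  a *: (u, v) = (a *: u, a *: v) :> (U * V)%type.
Proof. by []. Qed.

(** Lifts, factorizations and extensions of linear maps are found below as
    graphs, which avoids choosing values compatibly. *)
Lemma linear_of_relation U V (G : (U * V)%type -> Prop) :
  submodule G -> (forall v, G (0, v) -> v = 0) ->
  (forall u, exists v, G (u, v)) ->
  exists g : {linear U -> V}, forall u v, G (u, v) <-> v = g u.
Proof.
move=> hG Gf Gt; have [f fP] := choice Gt.
have fun_ u v w : G (u, v) -> G (u, w) -> v = w.
  move=> Guv Guw; apply/eqP; rewrite -subr_eq0; apply/eqP; apply: Gf.
  by have := subB hG Guv Guw; rewrite pair_subr subrr.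
have [g gP] : exists g : {linear U -> V}, g =1 f.
  apply: bundle_linear => a u v; apply: (fun_ (a *: u + v)) => //.
  by have [_ /(_ a (u, f u) (v, f v) (fP u) (fP v))] := hG.
exists g => u v; rewrite gP; split=> [h|->] //; exact: fun_ h (fP u).
Qed.

Lemma lift_injection U V W (i : {linear W -> V}) (f : {linear U -> V}) :
  injective i -> (forall u, exists w, i w = f u) ->
  exists g : {linear U -> W}, forall u, i (g u) = f u.
Proof.
move=> ij fi.
have [|||g gP] := @linear_of_relation U W (fun p => i p.2 = f p.1).
- split=> [|a [u w] [u' w'] /= h h']; first by rewrite !linear0.
  by rewrite !linearP h h'.
- by move=> v /=; rewrite linear0 => h; apply: ij; rewrite linear0.
- exact: fi.
by exists g => u; apply: (iffRL (gP u _)).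
Qed.

Lemma factor_surjection U V W (p : {linear U -> W}) (f : {linear U -> V}) :
  (forall w, exists u, p u = w) -> (forall u, p u = 0 -> f u = 0) ->
  exists g : {linear W -> V}, forall u, g (p u) = f u.
Proof.
move=> ps fk.
have [|||g gP] := @linear_of_relation W V
   (fun q => exists u, p u = q.1 /\ f u = q.2).
- split=> [|a [w v] [w' v'] /= [u [<- <-]] [u' [<- <-]]].
    by exists 0; rewrite !linear0.
  by exists (a *: u + u'); rewrite !linearP.
- by move=> v /= [u [/fk h <-]].
- by move=> w; have [u <-] := ps w; exists (f u), u.
by exists g => u; apply/esym/(iffLR (gP _ _)); exists u.
Qed.

Lemma inclusion V (S : submodClosed V) :
  exists j : {linear submod_of S -> V}, forall x, j x = val x.
Proof. exact: bundle_linear. Qed.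

Lemma lift_free n U V (p : {linear U -> V}) (f : {linear 'rV[R]_n -> V}) :
  (forall x, exists u, p u = f x) ->
  exists g : {linear 'rV[R]_n -> U}, forall x, p (g x) = f x.
Proof.
move=> h; have [y yP] := choice (fun i => h (delta_mx 0 i)).
have [|g gE] := @bundle_linear 'rV[R]_n U (fun x => \sum_i x 0 i *: y i).
  move=> a u v; rewrite scaler_sumr -big_split /=.
  by apply: eq_bigr => i _; rewrite !mxE scalerDl scalerA.
exists g => x; rewrite gE linear_sum [in RHS](row_sum_delta x) linear_sum.
by apply: eq_bigr => i _; rewrite !linearZ yP.
Qed.

(** The graph G is itself a module, whose projections to V and E are the
    inclusion of the domain and the map to be extended. *)
Lemma injective_extend (E V : lmodType R) (G : (V * E)%type -> Prop) :
  injective_module E -> submodule G -> (forall e, G (0, e) -> e = 0) ->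
  exists g : {linear V -> E}, forall v e, G (v, e) -> g v = e.
Proof.
move=> Einj hG Gf.
pose A : lmodType R := submod_of (bundle hG).
have [j jE] : exists j : {linear A -> V}, forall x, j x = (val x).1.
  by apply: bundle_linear.
have [f fE] : exists f : {linear A -> E}, forall x, f x = (val x).2.
  by apply: bundle_linear.
have [|g gP] := Einj A V j f.
  move=> x y; rewrite !jE => exy; apply/val_inj.
  have /(iffLR (bundleP hG _)) := valP x.
  have /(iffLR (bundleP hG _)) := valP y.
  case: (val x) (val y) exy => [x1 x2] [y1 y2] /= -> Gy Gx.
  have := subB hG Gx Gy; rewrite pair_subr subrr => /Gf/eqP.
  by rewrite subr_eq0 => /eqP->.
exists g => v e Gve.
have Gve' : (v, e) \in bundle hG by apply/bundleP.
by have := gP (SubmodOf Gve'); rewrite jE fE.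
Qed.

End Submodules.
(** * Noetherian modules *)

Section Span.
Context {R : comNzRingType} {V : lmodType R}.
Implicit Types (S : V -> Prop) (l : seq V).

Fixpoint span l (y : V) : Prop :=
  if l is g :: l' then exists a t, span l' t /\ y = a *: g + t else y = 0.

Definition fg_submodule S := exists l, forall x, S x <-> span l x.

Lemma span_submodule l : submodule (span l).
Proof.
elim: l => [|g l [IH0 IH]]; split=> //=.
- by move=> a x y -> ->; rewrite scaler0 addr0.
- by exists 0, 0; rewrite scale0r addr0.
- move=> a x y [b [t [lt ->]]] [c [u [lu ->]]].
  exists (a * b + c), (a *: t + u); split; first exact: IH.
  by rewrite scalerDr scalerDl scalerA addrACA.
Qed.

Lemma span_mem l x : x \in l -> span l x.
Proof.
elim: l => //= g l IH; rewrite in_cons => /orP[/eqP->|/IH lx].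
  by exists 1, 0; split; [apply: sub0 (span_submodule l)|rewrite scale1r addr0].
by exists 0, x; rewrite scale0r add0r.
Qed.

Lemma span_least S l :
  submodule S -> (forall x, x \in l -> S x) -> forall x, span l x -> S x.
Proof.
move=> hS; elim: l => [|g l IH] lS x /=; first by move->; apply: sub0.
move=> [a [t [lt ->]]]; apply: hS.2; first by apply: lS; rewrite mem_head.
by apply: IH => // y yl; apply: lS; rewrite in_cons yl orbT.
Qed.

Lemma span_sum n (g : 'I_n -> V) (a : 'I_n -> R) :
  span (codom g) (\sum_i a i *: g i).
Proof.
elim/big_ind: _ => [|x y|i _]; first exact: sub0 (span_submodule _).
  exact: subD (span_submodule _).
by apply: (subZ _ (span_submodule _)); apply: span_mem; apply: codom_f.
Qed.

Lemma span_cat l1 l2 x y : span l1 x -> span l2 y -> span (l1 ++ l2) (x + y).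
Proof.
elim: l1 x => [|g l IH] x /=; first by move=> ->; rewrite add0r.
move=> [a [t [lt ->]]] ly; exists a, (t + y); split; first exact: IH.
by rewrite addrA.
Qed.

End Span.

Section Noetherian.
Context {R : comNzRingType} (hR : noetherian R).

Definition fg_module (M : lmodType R) := exists l : seq M, forall x, span l x.

Lemma fin_gen_module (M : lmodType R) : fin_gen M -> fg_module M.
Proof.
move=> [n [g gP]]; exists (codom g) => x; have [a ->] := gP x.
exact: span_sum.
Qed.

Lemma ideal_fg (I : R^o -> Prop) : submodule I -> fg_submodule I.
Proof.
move=> hI; have [n [g gP]] := hR (bundle hI).
exists (codom (fun i => val (g i) : R^o)) => x; split=> [Ix|].
  have Ix' : x \in bundle hI by apply/bundleP.
  have [j jE] := inclusion (bundle hI).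
  have [a /(congr1 j)] := gP (SubmodOf Ix').
  rewrite jE /= linear_sum => ->.
  rewrite (eq_bigr (fun i => a i *: (val (g i) : R^o))); first exact: span_sum.
  by move=> i _; rewrite linearZ jE.
apply: (span_least hI) => y /codomP[i ->].
exact: (iffLR (bundleP hI _) (valP (g i))).
Qed.

(** Induction on the number of generators: the coefficients of the first one
    form an ideal, and the remaining part has fewer generators. *)
Lemma span_noetherian (V : lmodType R) (l : seq V) (S : V -> Prop) :
  submodule S -> (forall x, S x -> span l x) -> fg_submodule S.
Proof.
elim: l S => [|g l IH] S hS lS.
  by exists [::] => x; split=> [/lS//|/= ->]; apply: sub0.
have hl := span_submodule l.
have [|l1 l1P] := IH (fun x => S x /\ span l x) _ (fun _ => @proj2 _ _).
  split=> [|a x y [Sx lx] [Sy ly]]; first by split; apply: sub0.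
  by split; [apply: hS.2|apply: hl.2].
have [|l2 l2P] := @ideal_fg (fun a => exists t, span l t /\ S (a *: g + t)).
  split=> [|a x y [t [lt St]] [u [lu Su]]].
    by exists 0; rewrite scale0r addr0; split; apply: sub0.
  exists (a *: t + u); split; first exact: hl.2.
  have -> : (a *: x + y) *: g + (a *: t + u) =
            a *: (x *: g + t) + (y *: g + u).
    by rewrite scalerDr scalerDl scalerA addrACA.
  exact: hS.2.
have [l3 [l3S l3P]] : exists l3, (forall x, x \in l3 -> S x) /\
    forall a, span l2 a -> exists t, span l t /\ span l3 (a *: g + t).
  have {l2P} : forall a, a \in l2 -> exists t, span l t /\ S (a *: g + t).
    by move=> a al; apply/l2P/span_mem.
  elim: l2 => [|b l2 IH2] h /=.
    exists [::]; split=> // a ->; exists 0; rewrite scale0r addr0.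
    by split; first exact: sub0.
  have [|l3 [l3S l3P]] := IH2.
    by move=> a al; apply: h; rewrite in_cons al orbT.
  have [t [lt St]] := h b (mem_head _ _).
  exists (b *: g + t :: l3); split=> [x|a [c [a' [/l3P[u [lu l3u]] ->]]]].
    by rewrite in_cons => /orP[/eqP->|/l3S].
  exists (c *: t + u); split; first exact: hl.2.
  exists c, (a' *: g + u); split=> //.
  by rewrite scalerDl scalerDr scalerA addrACA.
exists (l3 ++ l1) => x; split=> [Sx|].
  have [a [t [lt xE]]] := lS x Sx.
  have /l2P/l3P[u [lu l3u]] : exists t, span l t /\ S (a *: g + t).
    by exists t; rewrite -xE.
  rewrite -[x](subrK (a *: g + u)) addrC; apply: span_cat => //.
  apply/l1P; split.
    by apply: subB => //; apply: span_least l3S _ _.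
  by rewrite xE opprD addrACA subrr add0r; apply: subB.
apply: span_least => // y; rewrite mem_cat => /orP[/l3S //|yl].
by have [] := iffRL (l1P y) (span_mem yl).
Qed.

Lemma submodule_fg (M : lmodType R) (S : M -> Prop) :
  fg_module M -> submodule S -> fg_submodule S.
Proof. by move=> [l lP] hS; apply: (span_noetherian (l := l)). Qed.

(** A family without a maximal member would contain a strictly increasing
    sequence, whose union is finitely generated and so equal to one of its
    terms. *)
Lemma maximal_submodule (M : lmodType R) (F : (M -> Prop) -> Prop) S0 :
  fg_module M -> (forall S, F S -> submodule S) -> F S0 ->
  exists S, F S /\
    forall S', F S' -> (forall x, S x -> S' x) -> forall x, S' x -> S x.
Proof.
move=> fgM Fs FS0; apply: contrapT => noMax.
have next (S : {S | F S}) : exists S' : {S | F S},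
    (forall x, sval S x -> sval S' x) /\ exists x, sval S' x /\ ~ sval S x.
  apply: contrapT => noS; apply: noMax; exists (sval S).
  split; first exact: svalP.
  move=> S' FS' SS' x S'x; apply: contrapT => nSx; apply: noS.
  by exists (exist _ S' FS'); split=> //; exists x.
have [f fP] := choice next.
pose c n := sval (iter n f (exist _ S0 FS0)).
have cs n : submodule (c n) by apply/Fs/svalP.
have cle n k x : c n x -> c (n + k)%N x.
  elim: k => [|k IH]; first by rewrite addn0.
  by rewrite addnS => /IH; apply: (fP _).1.
have [|l lP] := @submodule_fg M (fun x => exists n, c n x) fgM.
  split=> [|a x y [n cx] [k cy]]; first by exists 0%N; apply: sub0 (cs _).
  exists (n + k)%N; apply: (cs _).2; first exact: cle.
  by rewrite addnC; apply: cle.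
have [N lN] : exists N, forall x, x \in l -> c N x.
  have : forall x, x \in l -> exists n, c n x.
    by move=> x xl; apply/lP/span_mem.
  elim: (l) => [|g l' IH] h; first by exists 0%N.
  have [|N lN] := IH; first by move=> x xl; apply: h; rewrite in_cons xl orbT.
  have [n cg] := h g (mem_head _ _).
  exists (N + n)%N => x; rewrite in_cons => /orP[/eqP->|/lN].
    by rewrite addnC; apply: cle.
  exact: cle.
have [_ [x [cx ncx]]] := fP (iter N f (exist _ S0 FS0)).
apply: ncx; apply: (span_least (cs N) lN); apply/lP.
by exists N.+1.
Qed.

Lemma row_fg n : fg_module ('rV[R]_n : lmodType R).
Proof.
by exists (codom (fun i => delta_mx 0 i)) => x; rewrite [x]row_sum_delta; apply: span_sum.
Qed.

Lemma submod_of_fg (V : lmodType R) (S : V -> Prop) (hS : submodule S) :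
  fg_module V -> fg_module (submod_of (bundle hS)).
Proof.
move=> /submodule_fg/(_ hS)[l lP].
have lS x : x \in l -> S x by move=> xl; apply/lP/span_mem.
suff [l' l'P] : exists l' : seq (submod_of (bundle hS)),
    forall x, span l (val x) -> span l' x.
  by exists l' => x; apply: l'P; apply/lP/(iffLR (bundleP hS _))/valP.
have [j jE] := inclusion (bundle hS).
elim: l lS {lP} => [|g l IH] lS.
  by exists [::] => x x0; apply: val_inj; rewrite x0 -jE linear0.
have [|l' l'P] := IH; first by move=> x xl; apply: lS; rewrite in_cons xl orbT.
have Sg : g \in bundle hS by apply/bundleP/lS/mem_head.
exists (SubmodOf Sg :: l') => x [a [t [lt xE]]].
exists a, (x - a *: SubmodOf Sg); split; last by rewrite addrC subrK.
by apply: l'P; rewrite -jE linearB linearZ !jE xE addrC addKr.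
Qed.

Lemma span_coef (V : lmodType R) (l : seq V) x :
  span l x -> exists a : 'I_(size l) -> R, x = \sum_i a i *: l`_i.
Proof.
elim: l x => [|g l IH] x /=; first by exists (fun=> 0); rewrite big_ord0.
move=> [a [t [/IH[b ->] ->]]].
exists (fun i => if unlift ord0 i is Some j then b j else a).
rewrite big_ord_recl unlift_none /=; congr (_ + _).
by apply: eq_bigr => i _; rewrite liftK.
Qed.

Lemma presentation (M : lmodType R) : fg_module M ->
  exists n (q : {linear 'rV[R]_n -> M}), forall x, exists y, q y = x.
Proof.
move=> [l lP]; have [|q qE] := @bundle_linear R 'rV[R]_(size l) M
  (fun y => \sum_i y 0 i *: l`_i).
  move=> a u v; rewrite scaler_sumr -big_split /=.
  by apply: eq_bigr => i _; rewrite !mxE scalerDl scalerA.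
exists (size l), q => x; have [a ->] := span_coef (lP x).
by exists (\row_i a i); rewrite qE; apply: eq_bigr => i _; rewrite mxE.
Qed.

Lemma power_fg r (M : lmodType R) : fg_module M -> fg_module ('I_r -> M).
Proof.
move=> [l lP]; pose d i x : 'I_r -> M := fun j => if j == i then x else 0.
have [L LP] : exists L : seq ('I_r -> M), forall i g, g \in l -> d i g \in L.
  exists (flatten [seq [seq d i g | g <- l] | i <- enum 'I_r]) => i g gl.
  by apply/flatten_mapP; exists i; rewrite ?mem_enum // map_f.
exists L => x; have -> : x = \sum_i d i (x i).
  apply/funext => j; rewrite fct_sumE (bigD1 j) //= {1}/d eqxx big1 ?addr0 //.
  by move=> i ij; rewrite /d eq_sym (negPf ij).
elim/big_ind: _ => [|y z|i _]; first exact: sub0 (span_submodule _).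
  exact: subD (span_submodule _).
apply: (@span_least R M (fun y => span L (d i y)) l) => // [|g gl].
  have hL := span_submodule L.
  split=> [|a y z Ly Lz]; last first.
    have -> : d i (a *: y + z) = a *: d i y + d i z.
      apply/funext => j; rewrite !fctE /d; case: eqP => // _.
      by rewrite scaler0 addr0.
    exact: hL.2.
  have -> : d i 0 = 0 by apply/funext => j; rewrite /d; case: eqP.
  exact: sub0 hL.
by apply/span_mem/LP.
Qed.

End Noetherian.

(** * Local rings *)

Section Local.
Context {R : comNzRingType} (hR : noetherian R) (m : idealr R).
Hypothesis hm : local_ring m.

Lemma maximal1 : (1 : R) \notin m.
Proof. by rewrite idealr1. Qed.

Lemma maximal_sub : submodule (fun a : R^o => a \in m).
Proof.
split=> [|a x y xm ym]; first exact: idealr0.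
exact: (rpredD (idealMr a xm) ym).
Qed.

Lemma ring_fg : fg_module (R^o : lmodType R).
Proof.
exists [:: 1] => x; exists x, 0; split=> //.
by rewrite addr0 [_ *: _]mulr1.
Qed.

Lemma proper_in_maximal (I : R^o -> Prop) :
  submodule I -> ~ I 1 -> forall a, I a -> a \in m.
Proof.
move=> hI nI1.
have [J [[hJ nJ1 IJ] Jmax]] := @maximal_submodule R hR R^o
  (fun J => [/\ submodule J, ~ J 1 & forall a, I a -> J a]) I ring_fg
  (fun _ h => let: And3 h1 _ _ := h in h1) (And3 hI nI1 (fun _ => id)).
pose SP : {pred R} := fun x => `[< J x >].
have SPc : idealr_closed SP.
  split; first by apply/asboolP; apply: sub0 hJ.
    by apply/asboolP.
  by move=> a u v /asboolP Ju /asboolP Jv; apply/asboolP; apply: hJ.2.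
pose K : idealr R := HB.pack_for (idealr R) SP (isIdealr.Build R SP SPc).
have KP x : (x \in K) <-> J x.
  by split=> [/asboolP|h]; last apply/asboolP.
have Kmax : maximal_ideal K.
  move=> L KL x; apply/idP/idP => [xL|/KL //]; apply/KP.
  apply: (Jmax (fun x => x \in L)) => //; last by move=> y /KP/KL.
  split=> [||a /IJ/KP/KL //].
    split=> [|a u v uL vL]; first exact: idealr0.
    exact: (rpredD (idealMr a uL) vL).
  by rewrite idealr1.
by move=> a /IJ/KP; rewrite (hm.2 K Kmax).
Qed.

Lemma local_unit a : a \notin m -> exists b, b * a = 1.
Proof.
move=> am; apply: contrapT => na.
have := @proper_in_maximal (fun x => exists b, x = b * a) _ _ a.
have h1 : submodule (fun x : R^o => exists b, x = b * a).
  split=> [|c x y [b ->] [b' ->]]; first by exists 0; rewrite mul0r.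
  by exists (c * b + b'); rewrite mulrDl -mulrA.
move=> /(_ h1) h; case/negP: am; apply: h; last by exists 1; rewrite mul1r.
by move=> [b e]; apply: na; exists b.
Qed.

Lemma local_unit1B a : a \in m -> exists b, b * (1 - a) = 1.
Proof.
move=> am; apply: local_unit; apply/negP => h.
have := subD maximal_sub h am; rewrite subrK => h1.
by have := maximal1; rewrite h1.
Qed.

Section Nakayama.
Context {V : lmodType R}.

Fixpoint mspan (l : seq V) (y : V) : Prop :=
  if l is g :: l' then exists a t, [/\ a \in m, mspan l' t & y = a *: g + t]
  else y = 0.

Lemma mspan_submodule l : submodule (mspan l).
Proof.
elim: l => [|g l [IH0 IH]]; split=> //=.
- by move=> a x y -> ->; rewrite scaler0 addr0.
- by exists 0, 0; rewrite scale0r addr0 idealr0.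
- move=> a x y [b [t [bm lt ->]]] [c [u [cm lu ->]]].
  exists (a * b + c), (a *: t + u); split; last 1 first.
  + by rewrite scalerDr scalerDl scalerA addrACA.
  + exact: maximal_sub.2.
  + exact: IH.
Qed.

Lemma mspan_scale l a x : a \in m -> span l x -> mspan l (a *: x).
Proof.
move=> am; elim: l x => [|g l IH] x /=; first by move->; rewrite scaler0.
move=> [b [t [lt ->]]]; exists (a * b), (a *: t).
by rewrite scalerDr scalerA; split=> //; [rewrite mulrC; apply: idealMr|apply: IH].
Qed.

Lemma nakayama_seq (L : V -> Prop) l : submodule L ->
  (forall g, g \in l -> exists t, mspan l t /\ L (g - t)) ->
  forall g, g \in l -> L g.
Proof.
move=> hL; elim: l => // h l IH hl.
have [t [[a [u [am lu ->]]] Lh]] := hl h (mem_head _ _).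
have [b ba] := local_unit1B am.
have Lh' : L (h - b *: u).
  have := subZ b hL Lh.
  have -> : h - (a *: h + u) = (1 - a) *: h - u.
    by rewrite opprD addrA scalerBl scale1r.
  by rewrite scalerBr scalerA ba scale1r.
have Ll g : g \in l -> L g.
  apply: IH => {}g gl.
  have [|t' [[c [v [cm lv ->]]] Lg]] := hl g; first by rewrite in_cons gl orbT.
  exists (c *: (b *: u) + v); split.
    by apply: (mspan_submodule l).2 => //; apply: subZ (mspan_submodule l) lu.
  have -> : g - (c *: (b *: u) + v) =
            c *: (h - b *: u) + (g - (c *: h + v)).
    rewrite [RHS]addrCA; congr (g + _); rewrite scalerBr !opprD addrA.
    by congr (_ - v); rewrite addrAC subrr add0r.
  exact: hL.2.
move=> g; rewrite in_cons => /orP[/eqP->|/Ll //].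
rewrite -[h](subrK (b *: u)); apply: subD => //; apply: subZ => //.
apply: (@span_least R V L l) => //.
elim: (l) u lu {Lh Lh' Ll} => [|g' l' IHl] u /=; first by [].
by move=> [c [v [_ lv ->]]]; exists c, v; split=> //; apply: IHl.
Qed.

(** Nakayama's lemma for K modulo L: each generator is expressed through the
    remaining ones modulo L, because 1 - a is a unit for a in m. *)
Lemma nakayama (L K : V -> Prop) l :
  submodule L -> (forall x, K x -> exists y, span l y /\ L (x - y)) ->
  (forall x, x \in l -> K x) ->
  (forall x, K x -> exists a y z, [/\ a \in m, K y, L z & x = a *: y + z]) ->
  forall x, K x -> L x.
Proof.
move=> hL Kl lK Km.
have Ll : forall g, g \in l -> L g.
  apply: nakayama_seq => // g /lK/Km[a [y [z [am Ky Lz ->]]]].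
  have [y' [ly' Ly]] := Kl y Ky.
  exists (a *: y'); split; first exact: mspan_scale.
  rewrite addrAC -scalerBr; exact: hL.2.
move=> x /Kl[y [ly Lxy]]; rewrite -[x](subrK y); apply: subD => //.
exact: span_least ly.
Qed.

End Nakayama.
End Local.

(** * Injective modules *)

Section Baer.
Context {R : comNzRingType} {E : lmodType R}.

(** Baer's criterion. A partial extension is a functional graph; Zorn's lemma
    gives a maximal one, and the hypothesis, applied to the coefficients that
    move b into its domain, extends it to any further b. *)
Lemma baer :
  (forall G : (R^o * E)%type -> Prop, submodule G ->
     (forall e, G (0, e) -> e = 0) ->
     exists e, forall a c, G (a, c) -> c = a *: e) ->
  injective_module E.
Proof.
move=> hE A B j f jI.
pose ext (G : (B * E)%type -> Prop) :=
  [/\ submodule G, forall e, G (0, e) -> e = 0 & forall a, G (j a, f a)].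
pose le (s t : {G | ext G}) := `[< forall p, sval s p -> sval t p >].
have ext0 : ext (fun p => exists a, j a = p.1 /\ f a = p.2).
  split=> [|e /= [a [+ <-]]|a]; last by exists a.
    split=> [|r [p1 p2] [q1 q2] /= [a [<- <-]] [b [<- <-]]]; first by exists 0; rewrite !linear0.
    by exists (r *: a + b); rewrite !linearP.
  by rewrite -(linear0 j) => /jI ->; rewrite linear0.
have [||Ch totCh|[G [hG Gf Gj]] Gmax] := ZL_preorder (exist _ _ ext0) (R := le).
- by move=> t; apply/asboolP.
- by move=> r s t /asboolP rs /asboolP st; apply/asboolP => p /rs/st.
- have [[s0 Chs0]|noCh] := pselect (exists s, Ch s); last first.
    by exists (exist _ _ ext0) => s Chs; case: noCh; exists s.
  have extU : ext (fun p => exists s, Ch s /\ sval s p).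
    split.
    + split=> [|r p q [s [Chs sp]] [t [Cht tq]]].
        by exists s0; split=> //; apply: sub0; case: (svalP s0).
      have [/asboolP st|/asboolP ts] := totCh s t Chs Cht.
        by exists t; split=> //; have [ht _ _] := svalP t; apply: ht.2 => //; apply: st.
      by exists s; split=> //; have [hs _ _] := svalP s; apply: hs.2 => //; apply: ts.
    + by move=> e [s [_ se]]; have [_ + _] := svalP s; apply.
    + by move=> a; exists s0; split=> //; have [_ _] := svalP s0; apply.
  by exists (exist _ _ extU) => s Chs; apply/asboolP => p sp; exists s.
have [b|g gP] := @linear_of_relation R B E G hG Gf; last first.
  by exists g => x; apply/esym/(iffLR (gP _ _)).
have [||e eP] := hE (fun p => G (p.1 *: b, p.2)).
- split=> [|r [a c] [a' c'] /= Ga Ga'].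
    by rewrite /= scale0r; apply: sub0 hG.
  rewrite scalerDl -scalerA.
  exact: (hG.2 r _ _ Ga Ga').
- by move=> e /=; rewrite scale0r; apply: Gf.
have extG' : ext (fun p => exists a q, G q /\ p = q + (a *: b, a *: e)).
  split.
  - split=> [|r _ _ [a [q [Gq ->]]] [a' [q' [Gq' ->]]]].
      by exists 0, 0; split; [apply: sub0|rewrite add0r !scale0r].
    exists (r * a + a'), (r *: q + q'); split; first exact: hG.2.
    have -> : ((r * a + a') *: b, (r * a + a') *: e) =
       r *: (a *: b, a *: e) + (a' *: b, a' *: e) :> (B * E)%type.
      by rewrite !scalerDl -!scalerA.
    by rewrite scalerDr addrACA.
  - move=> c [a [[b' c'] [Gq]]].
    rewrite pair_addr => -[/esym/eqP].
    rewrite addr_eq0 => /eqP eb ->.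
    have : G ((- a) *: b, c') by rewrite scaleNr -eb.
    by move/eP => ->; rewrite scaleNr addNr.
  - by move=> a; exists 0, (j a, f a); split=> //; rewrite !scale0r addr0.
exists e; have /Gmax/asboolP : le (exist _ _ (And3 hG Gf Gj)) (exist _ _ extG').
  by apply/asboolP => p /= Gp; exists 0, p; rewrite !scale0r addr0.
move=> /(_ (b, e)) /=; apply.
by exists 1, 0; rewrite !scale1r add0r; split=> //; apply: sub0.
Qed.

End Baer.

Section RationalsModIntegers.

Definition rational_module : lmodType int := zmodule rat.

Lemma integers_submodule :
  submodule (fun x : rational_module => exists n : int, x = n%:~R :> rat).
Proof.
split=> [|a x y [n ->] [k ->]]; first by exists 0.
exists (n * a + k); rewrite intrD; congr (_ + _).
by rewrite scalezrE mulrzA.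
Qed.

(** The group Q/Z. *)
Definition rat_mod_int : lmodType int := quotmod (bundle integers_submodule).

Lemma rat_mod_int_eq0 (x : rational_module) :
  quotmod_pi (bundle integers_submodule) x = 0 <-> exists n : int, x = n%:~R :> rat.
Proof.
split=> [/quotmod_eq0/bundleP //|h]; exact/quotmod_eq0/bundleP.
Qed.

Lemma rat_mod_int_divisible (n : int) (y : rat_mod_int) :
  n != 0 -> exists z, n *: z = y.
Proof.
move=> n0; have [q <-] := quotmod_pi_surj y.
pose q' : rational_module := (q : rat) / n%:~R.
exists (quotmod_pi _ q'); rewrite -linearZ; congr (quotmod_pi _ _).
by rewrite scalezrE -mulrzr divfK // intr_eq0.
Qed.

Lemma int_euclid (P : int -> Prop) (n : nat) : (0 < n)%N ->
  (forall k : nat, (0 < k)%N -> P k -> (n <= k)%N) ->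
  (forall q a : int, P a -> P (a - q * n)) ->
  forall a : int, P a -> a = (a %/ n)%Z * n.
Proof.
move=> n0 nmin Pn a Pa; apply/eqP; rewrite -subr_eq0; apply/eqP.
have nz : n%:Z != 0 by rewrite eqz_nat -lt0n.
have := Pn (a %/ n)%Z a Pa.
have : 0 <= a - (a %/ n)%Z * n by apply: modz_ge0.
have : a - (a %/ n)%Z * n < n by apply: ltz_pmod.
case: (a - _) => // -[|k] // kn _ Pk.
by have := nmin k.+1 isT Pk; rewrite leqNgt => /negP[].
Qed.

Lemma least_positive (P : int -> Prop) (k : int) :
  k != 0 -> P k -> P (- k) ->
  exists n : nat, [/\ (0 < n)%N, P n &
    forall l : nat, (0 < l)%N -> P l -> (n <= l)%N].
Proof.
move=> k0 Pk PNk.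
have ex : exists n : nat, (0 < n)%N && `[< P n >].
  exists `|k|%N; rewrite absz_gt0 k0; apply/asboolP.
  by case: k {k0} Pk PNk => n // _; rewrite NegzE opprK.
have [n /andP[n0 /asboolP Pn] nmin] := ex_minnP ex.
exists n; split=> // l l0 Pl; apply: nmin; rewrite l0; exact/asboolP.
Qed.

Lemma rat_mod_int_injective : injective_module rat_mod_int.
Proof.
apply: baer => G hG Gf.
have [[[k c] [Gk /= k0]]|noG] := pselect (exists p, G p /\ p.1 != 0); last first.
  exists 0 => a c Gac; rewrite scaler0; apply: Gf.
  suff -> : 0 = a by [].
  by apply/esym/eqP; apply: contrapT => /negP a0; apply: noG; exists (a, c).
pose P (a : int) := exists c, G (a, c).
have [||n [n0 [c' Gn] nmin]] := @least_positive P k k0.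
- by exists c.
- by exists (- c); apply: subN Gk.
have [|e eE] := @rat_mod_int_divisible n c'; first by rewrite eqz_nat -lt0n.
exists e => a d Gad.
have aE : a = (a %/ n)%Z * n.
  apply: (@int_euclid P) => //; last by exists d.
  move=> q b [d' Gb]; exists (d' - q *: c').
  by have := subB hG Gb (subZ q hG Gn).
have := subB hG Gad (subZ (a %/ n)%Z hG Gn).
rewrite pair_subr.
have -> : (a : int^o) - (a %/ n)%Z *: (n%:Z : int^o) = 0 by rewrite {1}aE subrr.
by move=> /Gf/eqP; rewrite subr_eq0 => /eqP ->; rewrite {2}aE -scalerA eE.
Qed.

(** The subgroup generated by x maps to Q/Z without killing x, by 1/n if x has
    order n and by 1/2 if x has infinite order; this map extends to M. *)
Lemma character_separates (M : zmodType) (x : M) : x != 0 ->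
  exists phi : {linear zmodule M -> rat_mod_int}, phi x != 0.
Proof.
move=> x0; pose y : zmodule M := x.
suff [e [e0 eP]] : exists e : rat_mod_int, e != 0 /\
    forall k : int, k *: y = 0 -> k *: e = 0.
  have [||phi phiP] := @injective_extend int rat_mod_int (zmodule M)
    (fun p => exists k : int, p = (k *: y, k *: e)) rat_mod_int_injective.
  - split=> [|a _ _ [k ->] [l ->]]; first by exists 0; rewrite !scale0r.
    by exists (a * k + l); rewrite !scalerDl -!scalerA.
  - by move=> c [k [/esym/eP k0 ->]].
  exists phi; suff -> : phi x = e by [].
  by apply: phiP; exists 1; rewrite !scale1r.
pose P (k : int) := k *: y = 0.
have [[k [k0 Pk]]|noP] := pselect (exists k, k != 0 /\ P k).
  have [|n [n0 Pn nmin]] := @least_positive P k k0 Pk.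
    by rewrite /P scaleNr Pk oppr0.
  have nn0 : n%:R != 0 :> rat by rewrite Num.Theory.pnatr_eq0 -lt0n.
  pose q : rational_module := (n%:R^-1 : rat).
  exists (quotmod_pi _ q); split.
    apply/eqP => /rat_mod_int_eq0[z zE].
    have : (z * n)%:~R = 1 :> rat.
      by rewrite intrM -zE -pmulrn mulVf.
    move/eqP; rewrite -[1]/(1%:~R) eqr_int => /eqP zn1.
    have n1 : n = 1%N.
      have := congr1 absz zn1; rewrite abszM /= => /eqP.
      by rewrite muln_eq1 => /andP[_ /eqP].
    by move: Pn; rewrite n1 /P scale1r => /eqP; apply/negP.
  move=> l Pl; rewrite -linearZ; apply/rat_mod_int_eq0.
  exists (l %/ n)%Z; rewrite scalezrE -mulrzr mulrC.
  have {1}-> : l = (l %/ n)%Z * n.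
    apply: (@int_euclid P) => // b a Pa.
    by rewrite /P scalerBl Pa -scalerA Pn scaler0 subrr.
  by rewrite intrM -pmulrn mulfK.
pose q : rational_module := (2%:R^-1 : rat).
exists (quotmod_pi _ q); split.
  apply/eqP => /rat_mod_int_eq0[z zE].
  have : (z * 2)%:~R = 1 :> rat.
    by rewrite intrM -zE -pmulrn mulVf.
  move/eqP; rewrite -[1]/(1%:~R) eqr_int => /eqP zn1.
  by have := congr1 absz zn1; rewrite abszM /= => /eqP; rewrite muln_eq1 andbF.
move=> k Pk; have [->|k0] := eqVneq k 0; first by rewrite scale0r.
by case: noP; exists k.
Qed.

End RationalsModIntegers.

Lemma additive_int_linear (M : zmodType) (N : lmodType int) (f : M -> N) :
  (forall x y, f (x + y) = f x + f y) ->
  exists g : {linear zmodule M -> N}, forall x, g x = f x.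
Proof.
move=> fD.
have f0 : f 0 = 0 by apply/eqP; rewrite -(subrr (f 0)) -{2}[0]addr0 fD addrK.
have fB : zmod_morphism f.
  move=> x y; apply/eqP; rewrite eq_sym subr_eq -fD subrK; exact/eqP.
pose F : {additive M -> N} :=
  HB.pack_for {additive M -> N} f (GRing.isZmodMorphism.Build M N f fB).
apply: bundle_linear => a x y; rewrite fD; congr (_ + _).
by rewrite -[a in RHS]intz scaler_int; apply: (raddfMz F).
Qed.

Section Cofree.
Context {R : comNzRingType} (K : Type).

Let additive_family (F : K -> R -> rat_mod_int) :=
  forall k r s, F k (r + s) = F k r + F k s.

Let additive_family_submodule :
  submodule (additive_family : ((K -> R -> rat_mod_int) : lmodType int) -> Prop).
Proof.
split=> [k r s|a F G hF hG k r s]; first by rewrite addr0.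
rewrite !fctE hF hG scalerDr.
by rewrite [LHS]addrACA.
Qed.

Let family := submod_of (bundle additive_family_submodule).

(** The R-module of K-indexed families in Hom_Z(R, Q/Z). *)
Definition cofree := family.
HB.instance Definition _ := GRing.Zmodule.on cofree.

Definition cofree_fun (F : cofree) : K -> R -> rat_mod_int := val (F : family).

Lemma cofree_funD F k r s :
  cofree_fun F k (r + s) = cofree_fun F k r + cofree_fun F k s.
Proof. exact: (iffLR (bundleP additive_family_submodule _) (valP (F : family))). Qed.

Lemma cofree_build (f : K -> R -> rat_mod_int) :
  (forall k r s, f k (r + s) = f k r + f k s) -> {F : cofree | cofree_fun F = f}.
Proof.
move=> fD.
have h : f \in bundle additive_family_submodule by apply/bundleP.
by exists (SubmodOf h).
Qed.

Lemma cofree_ext (F G : cofree) :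
  (forall k r, cofree_fun F k r = cofree_fun G k r) -> F = G.
Proof. by move=> FG; apply/val_inj/funext => k; apply/funext => r; apply: FG. Qed.

Definition cofree_scale (a : R) (F : cofree) : cofree :=
  sval (@cofree_build (fun k r => cofree_fun F k (r * a))
    (fun k r s => etrans (congr1 (cofree_fun F k) (mulrDl r s a))
                         (cofree_funD F k (r * a) (s * a)))).

Lemma cofree_scaleE a F k r :
  cofree_fun (cofree_scale a F) k r = cofree_fun F k (r * a).
Proof. by rewrite /cofree_scale; case: cofree_build => G /= ->. Qed.

Lemma cofree_addE F G k r :
  cofree_fun (F + G) k r = cofree_fun F k r + cofree_fun G k r.
Proof. by []. Qed.

Lemma cofree_scaleA a b F : cofree_scale a (cofree_scale b F) = cofree_scale (a * b) F.
Proof. by apply: cofree_ext => k r; rewrite !cofree_scaleE mulrA. Qed.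

Lemma cofree_scale1 : left_id 1 cofree_scale.
Proof. by move=> F; apply: cofree_ext => k r; rewrite cofree_scaleE mulr1. Qed.

Lemma cofree_scaleDr : right_distributive cofree_scale +%R.
Proof.
by move=> a F G; apply: cofree_ext => k r; rewrite cofree_scaleE !cofree_addE !cofree_scaleE.
Qed.

Lemma cofree_scaleDl F : {morph cofree_scale^~ F : a b / a + b}.
Proof.
move=> a b; apply: cofree_ext => k r.
by rewrite cofree_addE !cofree_scaleE mulrDr cofree_funD.
Qed.

HB.instance Definition _ := GRing.Zmodule_isLmodule.Build R cofree
  cofree_scaleA cofree_scale1 cofree_scaleDr cofree_scaleDl.

(** A linear map into Hom_Z(R, Q/Z) is the same as an additive map into Q/Z,
    so that injectivity is inherited from the group Q/Z. *)
Lemma cofree_injective : injective_module (cofree : lmodType R).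
Proof.
move=> A B j f jI.
have ext k : exists h : {linear zmodule B -> rat_mod_int},
    forall a, h (j a) = cofree_fun (f a) k 1.
  have [ev evE] := @additive_int_linear cofree rat_mod_int
    (fun F => cofree_fun F k 1) (fun F G => cofree_addE F G k 1).
  have [j' j'E] := @additive_int_linear A (zmodule B) j (raddfD j).
  have [f' f'E] := @additive_int_linear A (zmodule cofree) f (raddfD f).
  have [||h hP] := @injective_extend int rat_mod_int (zmodule B)
     (fun p => exists a, j' a = p.1 /\ ev (f' a) = p.2) rat_mod_int_injective.
  - split=> [|n [b c] [b' c'] /= [a [<- <-]] [a' [<- <-]]].
      by exists 0; rewrite !linear0.
    by exists (n *: (a : zmodule A) + a'); rewrite !linearP.
  - move=> c /= [a []]; rewrite -(linear0 j') !j'E => /jI -> <-.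
    by rewrite !linear0.
  by exists h => a; apply: hP; exists a; rewrite j'E evE f'E.
have [h hP] := choice ext.
have gD (b : B) k (r s : R) : h k ((r + s) *: b) = h k (r *: b) + h k (s *: b).
  by rewrite scalerDl raddfD.
pose g b := sval (@cofree_build (fun k r => h k (r *: b)) (gD b)).
have gE b k r : cofree_fun (g b) k r = h k (r *: b).
  by rewrite /g; case: cofree_build => G /= ->.
have [|g' g'E] := @bundle_linear R B cofree g.
  move=> a b c; apply: cofree_ext => k r.
  by rewrite cofree_addE cofree_scaleE !gE scalerDr scalerA raddfD.
exists g' => a; rewrite g'E; apply: cofree_ext => k r.
by rewrite gE -linearZ hP linearZ cofree_scaleE mul1r.
Qed.

End Cofree.

(** The element x goes to the family of the maps r |-> phi (r x), where phi runs
    over all characters of the group M; characters separate points. *)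
Lemma enough_injectives (R : comNzRingType) (M : lmodType R) :
  exists (E : lmodType R) (i : {linear M -> E}),
    injective_module E /\ injective i.
Proof.
pose K := {linear zmodule M -> rat_mod_int}.
exists (cofree K : lmodType R).
have iD x (k : K) (r s : R) : k ((r + s) *: x) = k (r *: x) + k (s *: x).
  by rewrite scalerDl raddfD.
pose i x := sval (cofree_build (iD x)).
have iE x (k : K) r : cofree_fun (i x) k r = k (r *: x).
  by rewrite /i; case: cofree_build => G /= ->.
have [|i' i'E] := @bundle_linear R M (cofree K) i.
  move=> a x y; apply: cofree_ext => k r.
  by rewrite cofree_addE cofree_scaleE !iE scalerDr scalerA raddfD.
exists i'; split; first exact: cofree_injective.
move=> x y; rewrite !i'E => ixy; apply/eqP; rewrite -subr_eq0.
apply/negP => /negP/character_separates[phi] /negP; apply.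
rewrite raddfB subr_eq0; apply/eqP.
by have := congr1 (fun F => cofree_fun F phi 1) ixy; rewrite /= !iE !scale1r.
Qed.

(** * Cosyzygies *)

(** A chain of short exact sequences 0 -> C_j -> I_j -> C_(j+1) -> 0 with
    injective middle terms: an injective resolution of C_0, cut into pieces. *)
Record cosyzygies (R : comNzRingType) := Cosyzygies {
  cosyz : nat -> lmodType R;
  hull : nat -> lmodType R;
  cosyz_in : forall j, {linear cosyz j -> hull j};
  cosyz_out : forall j, {linear hull j -> cosyz j.+1};
  cosyz_in_inj : forall j, injective (cosyz_in j);
  cosyz_out_surj : forall j c, exists e, cosyz_out j e = c;
  cosyz_exact : forall j e, cosyz_out j e = 0 <-> exists c, cosyz_in j c = e;
  hull_injective : forall j, injective_module (hull j)
}.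

Lemma choice_dep (T : Type) (U : T -> Type) (P : forall t, U t -> Prop) :
  (forall t, exists u, P t u) -> exists f, forall t, P t (f t).
Proof. by move=> h; exists (fun t => sval (cid (h t))) => t; apply: svalP. Qed.

Section Resolution.
Context {R : comNzRingType}.

Lemma cokernel_exists (U V : lmodType R) (i : {linear U -> V}) :
  exists (C : lmodType R) (p : {linear V -> C}),
    (forall c, exists v, p v = c) /\
    (forall v, p v = 0 <-> exists u, i u = v).
Proof.
have hS : submodule (fun v => exists u, i u = v).
  split=> [|a _ _ [u <-] [v <-]]; first by exists 0; rewrite linear0.
  by exists (a *: u + v); rewrite linearP.
exists (quotmod (bundle hS)), (quotmod_pi (bundle hS)).
split=> [c|v]; first exact: quotmod_pi_surj.
split=> [/quotmod_eq0/bundleP //|h]; exact/quotmod_eq0/bundleP.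
Qed.

Lemma cosyzygies_exist (M : lmodType R) :
  exists T : cosyzygies R, cosyz T 0 = M.
Proof.
have step (N : lmodType R) :
    exists (EC : (lmodType R * lmodType R)%type)
           (i : {linear N -> EC.1}) (p : {linear EC.1 -> EC.2}),
    [/\ injective i, forall c, exists e, p e = c,
        forall e, p e = 0 <-> exists c, i c = e & injective_module EC.1].
  have [E [i [Einj iI]]] := enough_injectives N.
  have [C [p [ps pE]]] := cokernel_exists i.
  by exists (E, C), i, p; split.
have [EC ECP] := choice step.
have [i iP] := choice_dep ECP.
have [p pP] := choice_dep iP.
pose C j := iter j (fun N : lmodType R => (EC N).2) M.
have iI j : injective (i (C j)) by case: (pP (C j)).
have pS j c : exists e, p (C j) e = c by case: (pP (C j)) => _ + _ _; apply.
have pE j e : p (C j) e = 0 <-> exists c, i (C j) c = e.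
  by case: (pP (C j)) => _ _ + _; apply.
have Einj j : injective_module (EC (C j)).1 by case: (pP (C j)).
by exists (@Cosyzygies R C (fun j => (EC (C j)).1)
  (fun j => i (C j)) (fun j => p (C j)) iI pS pE Einj).
Qed.

End Resolution.

(** * Finiteness of Ext *)

Section LinearMaps.
Context {R : comNzRingType}.
Implicit Types U V W : lmodType R.

Lemma linear_submodule U V : submodule (fun h : U -> V => linear h).
Proof. by split=> [|a f g fL gL]; [apply: linear_fun0|apply: linear_funP]. Qed.

Lemma linear_combination U V a (f g : {linear U -> V}) :
  exists h : {linear U -> V}, forall x, h x = a *: f x + g x.
Proof.
apply: bundle_linear; have [_ /(_ a f g)] := linear_submodule U V.
by apply; exact: linearP.
Qed.

End LinearMaps.

Section HomFG.
Context {R : comNzRingType} (hR : noetherian R).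

(** Some list spans all linear maps A -> C modulo those that lift along p; for
    C = C_(j+1) and p = cosyz_out j this says that Ext^(j+1)(A, C_0) is
    finitely generated. *)
Definition fg_hom (A I C : lmodType R) (p : {linear I -> C}) :=
  exists l : seq (A -> C), (forall h, h \in l -> linear h) /\
    forall h : {linear A -> C}, exists g, span l g /\
      exists h' : {linear A -> I}, forall a, h a - g a = p (h' a).

(** Evaluation at generators of A embeds the linear maps into a finite power of
    C, which is Noetherian. *)
Lemma linear_maps_fg (A C : lmodType R) : fg_module A -> fg_module C ->
  exists l : seq (A -> C), (forall h, h \in l -> linear h) /\
    forall h : {linear A -> C}, span l h.
Proof.
move=> [k kP] fgC; pose res (h : A -> C) := fun i : 'I_(size k) => h k`_i.
have [|l2 l2P] := @submodule_fg R hR ('I_(size k) -> C)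
    (fun v => exists h : {linear A -> C}, v = res h) (power_fg _ fgC).
  split=> [|a _ _ [f ->] [g ->]]; first by exists \0.
  have [h hE] := linear_combination a f g; exists h.
  by apply/funext => i; rewrite /res hE.
have [l [lL lP]] : exists l : seq (A -> C), (forall h, h \in l -> linear h) /\
    forall v, span l2 v -> exists h, span l h /\ v = res h.
  have {l2P} : forall v, v \in l2 -> exists h : {linear A -> C}, v = res h.
    by move=> v vl; apply/l2P/span_mem.
  elim: l2 => [|v l2 IH] hv.
    by exists [::]; split=> // v ->; exists 0.
  have [|l [lL lP]] := IH; first by move=> w wl; apply: hv; rewrite in_cons wl orbT.
  have [h0 vE] := hv v (mem_head _ _).
  exists ((h0 : A -> C) :: l); split=> [h|w [a [t [/lP[g [lg ->]] ->]]]].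
    by rewrite in_cons => /orP[/eqP->|/lL //]; apply: linearP.
  by exists (a *: (h0 : A -> C) + g); split; [exists a, g|rewrite vE].
exists l; split=> // h.
have /l2P/lP[g [lg hg]] : exists h' : {linear A -> C}, res h = res h' by exists h.
suff -> : h = g :> (A -> C) by [].
have [g' g'E] := bundle_linear (span_least (@linear_submodule R A C) lL lg).
apply/funext => x; have [a ->] := span_coef (kP x).
rewrite -g'E !linear_sum; apply: eq_bigr => i _; rewrite !linearZ g'E.
by have := congr1 (@^~ i) hg; rewrite /res /= => ->.
Qed.

(** Dimension shift. For 0 -> K -> F -> A -> 0 with F free and
    0 -> M -> I -> C -> 0 with I injective, a map K -> M extends to F -> I and
    then induces A -> C. Up to maps that lift to I, every A -> C arises so. *)
Lemma fg_hom_shift (M I C A : lmodType R) n (i : {linear M -> I})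
    (p : {linear I -> C}) (q : {linear 'rV[R]_n -> A}) (K : submodClosed 'rV[R]_n) :
  injective i -> (forall c, exists e, p e = c) ->
  (forall e, p e = 0 <-> exists c, i c = e) -> injective_module I ->
  (forall a, exists x, q x = a) -> (forall x, x \in K <-> q x = 0) ->
  (exists l : seq (submod_of K -> M), (forall h, h \in l -> linear h) /\
    forall u : {linear submod_of K -> M}, exists g, span l g /\
      exists w : {linear 'rV[R]_n -> M}, forall x, u x - g x = w (val x)) ->
  fg_hom A p.
Proof.
move=> iI pS pE Iinj qS KE [l [lL lP]].
have [j jE] := inclusion K.
have jI : injective j by move=> x y; rewrite !jE => /val_inj.
have induce (f : {linear 'rV[R]_n -> I}) (u : submod_of K -> M) :
    (forall x, f (val x) = i (u x)) ->
    exists h : {linear A -> C}, forall x, h (q x) = p (f x).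
  move=> fu; apply: (@factor_surjection R _ _ _ q (p \o f)) => // x /KE xK /=.
  by apply/pE; exists (u (SubmodOf xK)); rewrite -fu.
have [l' [l'L l'P]] : exists l' : seq (A -> C), (forall h, h \in l' -> linear h) /\
    forall g, span l g -> exists g', span l' g' /\
      exists f : {linear 'rV[R]_n -> I}, (forall x, f (val x) = i (g x)) /\
        forall x, g' (q x) = p (f x).
  elim: l lL {lP} => [|u l IH] lL.
    exists [::]; split=> // g ->; exists 0; split=> //.
    by exists \0; split=> x; rewrite /= linear0.
  have [|l' [l'L l'P]] := IH; first by move=> h hl; apply: lL; rewrite in_cons hl orbT.
  have [u' u'E] := bundle_linear (lL u (mem_head _ _)).
  have [f fE] := Iinj _ _ j (i \o u') jI.
  have fu x : f (val x) = i (u x) by rewrite -jE fE /= u'E.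
  have [h hE] := induce f u fu.
  exists ((h : A -> C) :: l'); split=> [g|g [a [t [/l'P[t' [l't' [f' [f't t'E]]]] ->]]]].
    by rewrite in_cons => /orP[/eqP->|/l'L //]; apply: linearP.
  exists (a *: (h : A -> C) + t'); split; first by exists a, t'.
  have [f'' f''E] := linear_combination a f f'.
  by exists f''; split=> x; rewrite f''E !fctE ?fu ?f't ?hE ?t'E !linearP.
exists l'; split=> // h.
have [v vE] := lift_free (p := p) (f := h \o q) (fun x => pS _).
have [|u uE] := @lift_injection R _ _ _ i (v \o j) iI.
  by move=> x; apply/pE; rewrite /= vE /= jE (iffLR (KE _) (valP x)) linear0.
have [g [lg [w wE]]] := lP u.
have [g' [l'g' [f [fg g'E]]]] := l'P g lg.
exists g'; split=> //.
have [d1 d1E] := linear_combination (-1) f v.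
have [d dE] := linear_combination (-1) (i \o w) d1.
have [|h' h'E] := factor_surjection (p := q) (f := d) qS.
  move=> x /KE xK; rewrite dE d1E /= -[x]/(val (SubmodOf xK)) fg -wE.
  have := uE (SubmodOf xK); rewrite /= jE => <-.
  by rewrite linearB !scaleN1r opprB addrACA subrr addNr addr0.
exists h' => a; have [x <-] := qS a; rewrite h'E dE d1E g'E !linearD !linearZ vE /=.
have -> : p (i (w x)) = 0 by apply/pE; exists (w x).
by rewrite scaler0 add0r scaleN1r addrC.
Qed.

(** For a free cover of A with kernel K, Ext^(j+2)(A, C_0) = Ext^(j+1)(K, C_0). *)
Lemma ext_fg (T : cosyzygies R) j (A : lmodType R) :
  fg_module (cosyz T 0) -> fg_module A -> fg_hom A (cosyz_out T j).
Proof.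
move=> fgC; elim: j A => [|j IH] A /presentation[n [q qS]].
all: have hK : submodule (fun x : 'rV[R]_n => q x = 0)
  by split=> [|a x y x0 y0]; rewrite ?linear0 // linearP x0 y0 scaler0 addr0.
all: have fgK := submod_of_fg hR hK (row_fg n).
all: apply: (fg_hom_shift (@cosyz_in_inj _ T _) (@cosyz_out_surj _ T _)
  (@cosyz_exact _ T _) (@hull_injective _ T _) qS (bundleP hK)).
  have [l [lL lP]] := linear_maps_fg fgK fgC.
  exists l; split=> // u.
  exists (u : submod_of (bundle hK) -> cosyz T 0); split; first exact: lP.
  by exists \0 => x; rewrite subrr.
have [l [lL lP]] := IH _ fgK; exists l; split=> // u.
have [g [lg [h' h'E]]] := lP u; exists g; split=> //.
have [k kE] := inclusion (bundle hK).
have [|f fE] := @hull_injective _ T j _ _ k h'.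
  by move=> x y; rewrite !kE => /val_inj.
by exists (cosyz_out T j \o f) => x; rewrite h'E /= -kE fE.
Qed.

End HomFG.

(** * Vanishing of Ext and injectivity *)

Section Bass.
Context {R : comNzRingType}.
Implicit Types (I : R^o -> Prop) (E M : lmodType R).

Definition killed I M (x : M) := forall a, I a -> a *: x = 0.

(** Multiplication by b is an injection R/(I : b) -> R/I, along which the map
    1 |-> x is extended. *)
Lemma injective_divide E I (b : R) (x : E) :
  injective_module E -> submodule I -> killed (fun a => I (a * b)) x ->
  exists e, killed I e /\ b *: e = x.
Proof.
move=> Einj hI Ix.
have [||g gP] := @injective_extend R E R^o
  (fun p => exists y a, I y /\ p = (y + a * b, a *: x)) Einj.
- split=> [|r _ _ [y [a [Iy ->]]] [y' [a' [Iy' ->]]]].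
    by exists 0, 0; rewrite mul0r addr0 scale0r; split=> //; apply: sub0.
  exists (r *: y + y'), (r * a + a'); split; first exact: hI.2.
  rewrite pair_scaler pair_addr scalerDl scalerA; congr (_, _).
  by rewrite mulrDl addrACA -mulrA scalerDr.
- move=> e [y [a [Iy [/esym/eqP + ->]]]]; rewrite addr_eq0 => /eqP yE.
  apply: Ix; rewrite -[a * b]opprK -yE; exact: subN.
have gE (a : R) : g a = a *: g 1 by rewrite -linearZZ [_ *: _]mulr1.
exists (g 1); split=> [a Ia|]; rewrite -gE; apply: gP.
  by exists a, 0; rewrite mul0r addr0 scale0r.
by exists 0, 1; rewrite add0r mul1r scale1r; split=> //; apply: sub0.
Qed.

(** Ext^(j+1)(R/I, C_0) = 0: maps R/I -> C_(j+1) lift to I_j. *)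
Definition lifts (T : cosyzygies R) j I :=
  forall c : cosyz T j.+1, killed I c ->
    exists e : hull T j, cosyz_out T j e = c /\ killed I e.

Context (hR : noetherian R) (m : idealr R) (hm : local_ring m).
Context (T : cosyzygies R).

(** The long exact sequence for 0 -> R/(I : a) -> R/I -> R/(I + a) -> 0. *)
Lemma lifts_step j I (a : R) : submodule I ->
  lifts T j (fun r => I (r * a)) ->
  lifts T j (fun r => exists y b, I y /\ r = y + b * a) -> lifts T j I.
Proof.
move=> hI Vcolon Vsum c Ic.
have [|e' [e'E e'I]] := Vcolon (a *: c); first by move=> r /Ic; rewrite scalerA.
have [e'' [e''I e''E]] := injective_divide (@hull_injective _ T j) hI e'I.
have [|e3 [e3E e3I]] := Vsum (c - cosyz_out T j e'').
  move=> _ [y [b [Iy ->]]]; rewrite scalerBr scalerDl Ic // add0r -linearZZ scalerDl.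
  by rewrite e''I // add0r -!scalerA e''E [cosyz_out T j _]linearZZ /= e'E subrr.
exists (e'' + e3); split=> [|r Ir]; first by rewrite linearD e3E addrC subrK.
rewrite scalerDr e''I // e3I ?addr0 //.
by exists r, 0; rewrite mul0r addr0.
Qed.

(** The long exact sequence for multiplication by x on R/I, where (I : x) = I. *)
Lemma killed_divisible j I (x : R) : submodule I -> (forall a, I (a * x) -> I a) ->
  lifts T j.+1 (fun r => exists y b, I y /\ r = y + b * x) ->
  forall c : cosyz T j.+1, killed I c ->
    exists c' : cosyz T j.+1, killed I c' /\ x *: c' = c.
Proof.
move=> hI Ix V c Ic.
have [|e [eI eE]] := @injective_divide _ I x (cosyz_in T j.+1 c)
    (@hull_injective _ T j.+1) hI.
  by move=> a /Ix/Ic ac; rewrite -linearZZ ac linear0.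
have [|e' [e'E e'I]] := V (cosyz_out T j.+1 e).
  move=> _ [y [b [Iy ->]]]; rewrite -linearZZ scalerDl eI // add0r -scalerA eE.
  by apply/cosyz_exact; exists (b *: c); apply: linearZZ.
have /cosyz_exact[c' c'E] : cosyz_out T j.+1 (e - e') = 0.
  by rewrite linearB e'E subrr.
have e'0 a : I a -> a *: e' = 0.
  by move=> Ia; apply: e'I; exists a, 0; rewrite mul0r addr0.
exists c'; split=> [a Ia|]; apply: (@cosyz_in_inj _ T j.+1).
  by rewrite linearZZ c'E linear0 scalerBr eI // e'0 // subrr.
rewrite linearZZ c'E scalerBr eE e'I ?subr0 //.
by exists 0, 1; rewrite add0r mul1r; split=> //; apply: sub0 hI.
Qed.

Lemma cyclic_map (S : submodClosed R^o) M (c : M) :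
  (forall a, a \in S -> a *: c = 0) ->
  exists h : {linear quotmod S -> M}, forall a, h (quotmod_pi S a) = a *: c.
Proof.
move=> Sc; have [f fE] : exists f : {linear R^o -> M}, forall a, f a = a *: c.
  by apply: bundle_linear => a b b'; rewrite scalerDl scalerA.
have [|h hE] := factor_surjection (f := f) (@quotmod_pi_surj _ _ S).
  by move=> a /quotmod_eq0/Sc; rewrite fE.
by exists h => a; rewrite hE fE.
Qed.

Lemma cyclic_ext_fg j I : fg_module (cosyz T 0) -> submodule I ->
  exists l : seq (cosyz T j.+1), (forall c, c \in l -> killed I c) /\
    forall c, killed I c -> exists c', span l c' /\
      exists e, killed I e /\ c - c' = cosyz_out T j e.
Proof.
move=> fgC hI; pose A : lmodType R := quotmod (bundle hI).
have pi0 (a : R^o) : I a -> quotmod_pi (bundle hI) a = 0.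
  by move=> Ia; apply/quotmod_eq0/bundleP.
pose u : A := quotmod_pi (bundle hI) 1.
have piE (a : R^o) : quotmod_pi (bundle hI) a = a *: u.
  by rewrite -linearZ [_ *: _]mulr1.
have Iu : killed I u by move=> a /pi0; rewrite piE.
have fgA : fg_module A.
  exists [:: u] => x; have [a <-] := quotmod_pi_surj x.
  by exists a, 0; rewrite addr0 piE.
have [l [lL lP]] := ext_fg hR j fgC fgA.
exists [seq h u | h <- l]; split=> [_ /mapP[h /lL/bundle_linear[h' h'E] ->] a Ia|c Ic].
  by rewrite -h'E -linearZZ Iu // linear0.
have [|h hE] := @cyclic_map (bundle hI) _ c; first by move=> a /bundleP/Ic.
have [g [lg [h' h'E]]] := lP h; exists (g u); split.
  elim: (l) g lg {h'E} => [|k l' IH] g /=; first by move->.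
  by move=> [a [t [l't ->]]]; exists a, (t u); split=> //; apply: IH.
exists (h' u); split=> [a Ia|]; first by rewrite -linearZZ Iu // linear0.
by rewrite -h'E hE scale1r.
Qed.

(** Vanishing of Ext^i(k, -) for all i > d propagates to all cyclic modules, by
    Noetherian induction on I. If some (I : a) is strictly larger than I, the
    sequence 0 -> R/(I : a) -> R/I -> R/(I + a) -> 0 reduces to larger ideals.
    Otherwise any x in m outside I is regular on R/I, so that
    Ext^i(R/I, -) = x Ext^i(R/I, -) because Ext^(i+1)(R/(I + x), -) = 0, and
    Nakayama's lemma applies. *)
Lemma bass d : fg_module (cosyz T 0) ->
  (forall j, (d <= j)%N -> lifts T j (fun a => a \in m)) ->
  forall I, submodule I -> forall j, (d <= j)%N -> lifts T j I.
Proof.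
move=> fgC Vm I0 hI0 j0 dj0; apply: contrapT => nV0.
pose F I := submodule I /\ exists j, (d <= j)%N /\ ~ lifts T j I.
have [||I [[hI [j [dj nV]]] Imax]] := maximal_submodule hR (F := F) (S0 := I0) ring_fg.
- by move=> S [].
- by split=> //; exists j0.
have V J : submodule J -> (forall a, I a -> J a) -> (exists a, J a /\ ~ I a) ->
    forall k, (d <= k)%N -> lifts T k J.
  move=> hJ IJ [a [Ja nIa]] k dk; apply: contrapT => nVJ.
  by apply/nIa/(Imax J) => //; split=> //; exists k.
have hsum a : submodule (fun r : R^o => exists y b, I y /\ r = y + b * a).
  split=> [|r _ _ [y [b [Iy ->]]] [y' [b' [Iy' ->]]]].
    by exists 0, 0; rewrite mul0r addr0; split=> //; apply: sub0.
  exists (r *: y + y'), (r * b + b'); split; first exact: hI.2.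
  by rewrite mulrDl addrACA -mulrA scalerDr.
have sumI a r : I r -> exists y b, I y /\ r = y + b * a.
  by move=> Ir; exists r, 0; rewrite mul0r addr0.
have suma a : exists y b, I y /\ a = y + b * a.
  by exists 0, 1; rewrite add0r mul1r; split=> //; apply: sub0.
have colon a : ~ I a -> forall r, I (r * a) -> I r.
  move=> nIa r Ira; apply: contrapT => nIr; apply: nV; apply: (@lifts_step j I a) => //.
    apply: V => //; last by exists r.
      split=> [|b x y Ix Iy]; first by rewrite mul0r; apply: sub0 hI.
      by rewrite mulrDl -mulrA; apply: hI.2.
    by move=> b Ib; rewrite mulrC; apply: (subZ a hI).
  apply: V => //; [exact: sumI|exists a; split=> //; exact: suma].
have nI1 : ~ I 1.
  move=> I1; apply: nV => c /(_ 1 I1); rewrite scale1r => ->.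
  by exists 0; rewrite linear0; split=> // a _; rewrite scaler0.
have Im := proper_in_maximal hR hm hI nI1.
have [x [xm nIx]] : exists x, x \in m /\ ~ I x.
  apply: contrapT => mI; apply: nV => c Ic.
  have [|e [eE em]] := Vm j dj c; last by exists e; split=> // a /Im/em.
  by move=> a am; apply: Ic; apply: contrapT => nIa; apply: mI; exists a.
have [l [lI lP]] := cyclic_ext_fg j fgC hI.
apply: nV => c Ic.
suff [e [Ie cE]] : exists e, killed I e /\ c = cosyz_out T j e by exists e.
apply: (nakayama hR hm (l := l) (K := @killed I (cosyz T j.+1))
  (L := fun c => exists e, killed I e /\ c = cosyz_out T j e)) => //.
  split=> [|a _ _ [e [Ie ->]] [e' [Ie' ->]]].
    by exists 0; rewrite linear0; split=> // a _; rewrite scaler0.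
  exists (a *: e + e'); rewrite linearP; split=> // b Ib.
  by rewrite scalerDr scalerA mulrC -scalerA Ie // Ie' // scaler0 addr0.
move=> y Iy; have [||y' [Iy' <-]] := @killed_divisible j I x hI _ _ y Iy.
- exact: colon.
- apply: V => //; [exact: sumI|by exists x; split=> //; exact: suma|exact: leqW].
exists x, y', 0; rewrite addr0; split=> //.
by exists 0; rewrite linear0; split=> // a _; rewrite scaler0.
Qed.

(** Ext^1(R/I, C_d) = Ext^(d+1)(R/I, C_0) = 0 is Baer's criterion for C_d. *)
Lemma cosyz_injective d :
  (forall I, submodule I -> lifts T d I) -> injective_module (cosyz T d).
Proof.
move=> V; apply: baer => G hG Gf.
have [||g gP] := @injective_extend R (hull T d) R^o
  (fun p => exists c, G (p.1, c) /\ p.2 = cosyz_in T d c) (@hull_injective _ T d).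
- split=> [|r [a e] [a' e'] /= [c [Gc ->]] [c' [Gc' ->]]].
    by exists 0; split=> [|/=]; [exact: hG.1|rewrite linear0].
  exists (r *: c + c'); rewrite linearP; split=> //; exact: (hG.2 _ _ _ Gc Gc').
- by move=> e /= [c [/Gf -> ->]]; rewrite linear0.
have gE (a : R) : g a = a *: g 1 by rewrite -linearZZ [_ *: _]mulr1.
have hI : submodule (fun a : R^o => exists c, G (a, c)).
  split=> [|r a b [c Gc] [c' Gc']]; first by exists 0; apply: sub0 hG.
  by exists (r *: c + c'); apply: (hG.2 _ _ _ Gc Gc').
have [|e' [e'E e'I]] := V _ hI (cosyz_out T d (g 1)).
  move=> a [c Gc]; rewrite -linearZZ -gE; apply/cosyz_exact.
  by exists c; rewrite (gP a (cosyz_in T d c)) //; exists c.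
have /cosyz_exact[c cE] : cosyz_out T d (g 1 - e') = 0 by rewrite linearB e'E subrr.
exists c => a c' Gac'; apply: (@cosyz_in_inj _ T d).
rewrite linearZZ cE scalerBr e'I ?subr0 -?gE; last by exists c'.
by apply/esym/gP; exists c'.
Qed.

Lemma lifts_injective j : injective_module (cosyz T j) -> forall I, lifts T j I.
Proof.
move=> Cinj I c Ic.
have [r rE] := Cinj _ _ (cosyz_in T j) idfun (@cosyz_in_inj _ T j).
have [e eE] := cosyz_out_surj c.
exists (e - cosyz_in T j (r e)); split.
  rewrite linearB eE; have -> : cosyz_out T j (cosyz_in T j (r e)) = 0.
    by apply/cosyz_exact; exists (r e).
  by rewrite subr0.
move=> a Ia; have /cosyz_exact[y yE] : cosyz_out T j (a *: e) = 0.
  by rewrite linearZZ eE Ic.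
by rewrite scalerBr -!linearZZ -yE rE subrr.
Qed.

Lemma next_injective j :
  injective_module (cosyz T j) -> injective_module (cosyz T j.+1).
Proof.
move=> Cinj A B i f iI.
have [r rE] := Cinj _ _ (cosyz_in T j) idfun (@cosyz_in_inj _ T j).
have [s sE] : exists s : {linear cosyz T j.+1 -> hull T j},
    forall e, s (cosyz_out T j e) = e - cosyz_in T j (r e).
  have [k kE] := linear_combination (-1) (cosyz_in T j \o r) idfun.
  have [|s sE] := factor_surjection (f := k) (@cosyz_out_surj _ T j).
    move=> e /cosyz_exact[c <-]; rewrite kE /= rE.
    by rewrite scaleN1r addNr.
  by exists s => e; rewrite sE kE scaleN1r addrC.
have [g gE] := @hull_injective _ T j _ _ i (s \o f) iI.
exists (cosyz_out T j \o g) => x; rewrite /= gE /=.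
have [e <-] := cosyz_out_surj (f x); rewrite sE linearB.
have -> : cosyz_out T j (cosyz_in T j (r e)) = 0 by apply/cosyz_exact; exists (r e).
by rewrite subr0.
Qed.

End Bass.

Section InjectiveDimension.
Context {R : comNzRingType}.

Lemma injective_finite (M : lmodType R) :
  injective_module M -> finite_injective_dimension M.
Proof.
move=> Minj.
pose Z : lmodType R := 'rV[R]_0.
have Z0 (z : Z) : z = 0 by apply/rowP => -[].
pose E i : lmodType R := if i is 0 then M else Z.
exists 0%N, E, (idfun : {linear M -> E 0}), (fun i => \0 : {linear E i -> E i.+1}).
split=> //.
- by case=> [//|i] A B j f _; exists \0 => x; rewrite [RHS]Z0 [LHS]Z0.
- by move=> y; split=> [_|_]; [exists y|].
- by move=> i y; split=> // _; exists 0; rewrite [LHS]Z0 [RHS]Z0.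
- by case=> // i _ x; rewrite [LHS]Z0.
Qed.

Lemma finite_injective_step (M I C : lmodType R) (i : {linear M -> I})
    (p : {linear I -> C}) :
  injective i -> (forall c, exists e, p e = c) ->
  (forall e, p e = 0 <-> exists c, i c = e) -> injective_module I ->
  finite_injective_dimension C -> finite_injective_dimension M.
Proof.
move=> iI pS pE Iinj [n [E [eta [delta [Einj etaI d0 dS En]]]]].
pose E' j : lmodType R := if j is j'.+1 then E j' else I.
exists n.+1, E', (i : {linear M -> E' 0}).
exists (fun j => match j return {linear E' j -> E' j.+1} with
  0 => (eta \o p : {linear I -> E 0%N}) | j'.+1 => delta j' end).
split=> //; [by case| | |by case].
- move=> y /=; rewrite -pE; split=> [|->]; last by rewrite linear0.
  by rewrite -(linear0 eta) => /etaI.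
- case=> [|j] y; last exact: dS.
  split=> [/d0[x xE]|[x xE]]; last by apply/d0; exists (p x).
  by have [e eE] := pS x; exists e; rewrite /= eE.
Qed.

Lemma cosyz_finite (T : cosyzygies R) d : injective_module (cosyz T d) ->
  finite_injective_dimension (cosyz T 0).
Proof.
move=> /injective_finite; elim: d => // d IH fC; apply: IH.
exact: (finite_injective_step (@cosyz_in_inj _ T d) (@cosyz_out_surj _ T d)
  (@cosyz_exact _ T d) (@hull_injective _ T d)).
Qed.

(** C_(j+1) is the image of the j-th differential; it vanishes for large j. *)
Lemma cosyzygies_of_resolution (M : lmodType R) : finite_injective_dimension M ->
  exists (T : cosyzygies R) (n : nat),
    cosyz T 0 = M /\ injective_module (cosyz T n).
Proof.
move=> [n [E [eta [delta [Einj etaI d0 dS En]]]]].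
pose C j : lmodType R := if j is j'.+1 then image_mod (delta j') else M.
have inE j : exists i : {linear C j -> E j}, injective i /\
    forall e, delta j e = 0 <-> exists c, i c = e.
  case: j => [|j]; first by exists eta.
  have [i iE] : exists i : {linear image_mod (delta j) -> E j.+1}, forall c, i c = val c.
    by apply: bundle_linear.
  exists i; split=> [x y|e]; first by rewrite !iE => /val_inj.
  rewrite dS; split=> [[x xE]|[c <-]].
    have h : e \in image_pred (delta j) by apply/asboolP; exists x.
    by exists (SubmodOf h); rewrite iE.
  by rewrite iE; have /asboolP := valP c.
have outE j : exists p : {linear E j -> C j.+1}, forall e, val (p e) = delta j e.
  have lift e : exists c : image_mod (delta j), val c = delta j e.
    have h : delta j e \in image_pred (delta j) by apply/asboolP; exists e.
    by exists (SubmodOf h).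
  have [p pE] := choice lift.
  have [|p' p'E] := @bundle_linear R (E j) (image_mod (delta j)) p.
    by move=> a x y; apply: val_inj; rewrite pE linearP /= !pE.
  by exists p' => e; rewrite p'E.
have [i iP] := choice_dep inE.
have [p pP] := choice_dep outE.
have pS j (c : C j.+1) : exists e, p j e = c.
  have /asboolP[e eE] := valP c.
  by exists e; apply: val_inj; rewrite pP eE.
have pE j e : p j e = 0 <-> exists c, i j c = e.
  rewrite -(iP j).2 -pP; split=> [->|h] //.
  by apply: val_inj; rewrite h.
exists (@Cosyzygies R C E i p (fun j => (iP j).1) pS pE Einj), n.+1; split=> //=.
move=> A B j f _.
have C0 (c : image_mod (delta n)) : c = 0.
  apply: val_inj; rewrite [RHS]/=.
  by rewrite [LHS](En n.+1 _ (val c)).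
by exists \0 => x; rewrite [LHS]C0 [RHS]C0.
Qed.

End InjectiveDimension.

(** * Ext in its second argument *)

Section ExtZero.
Context {R : comNzRingType} {k : lmodType R} (P : free_resolution k).
Implicit Types (M N : lmodType R).

Notation cochain i N := {linear 'rV[R]_(res_rank P i) -> N}.

Definition cocycle_map N i (f : cochain i N) :=
  forall x, f (res_diff P i x) = 0.

Definition coboundary_map N i : cochain i N -> Prop :=
  match i return cochain i N -> Prop with
  | 0 => fun f => forall x, f x = 0
  | j.+1 => fun f => exists g : cochain j N, forall x, f x = g (res_diff P j x)
  end.

(** Ext^i(k, N) = 0 *)
Definition ext_zero i N :=
  forall f : cochain i N, cocycle_map f -> coboundary_map f.

(** Ext^i(k, N) has dimension at most one over R/m. *)
Definition ext_rank_le1 (m : idealr R) i N :=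
  forall f g : cochain i N, cocycle_map f -> cocycle_map g ->
    exists a b (h : cochain i N), [/\ a \notin m \/ b \notin m,
      forall x, h x = a *: f x + b *: g x & coboundary_map h].

Lemma coboundary_map_eq N i (f g : cochain i N) :
  (forall x, f x = g x) -> coboundary_map f -> coboundary_map g.
Proof.
case: i f g => [|i] f g fg /=; first by move=> f0 x; rewrite -fg.
by move=> [h hE]; exists h => x; rewrite -fg.
Qed.

Lemma coboundary_map_comp M N i (u : {linear M -> N}) (f : cochain i M) (g : cochain i N) :
  (forall x, g x = u (f x)) -> coboundary_map f -> coboundary_map g.
Proof.
case: i f g => [|i] f g gE /=; first by move=> f0 x; rewrite gE f0 linear0.
by move=> [h hE]; exists (u \o h) => x; rewrite gE hE.
Qed.

Lemma diff_diff i x : res_diff P i (res_diff P i.+1 x) = 0.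
Proof. by apply/res_exactS; exists x. Qed.

Section FromExt.
Context (N : lmodType R) (i : nat).

Let Z := submod_of (@cocycle R k P N i).

Lemma ext_projection :
  exists cls : {linear Z -> Ext P N i}, (forall x, exists F, cls F = x) /\
    forall F, cls F = 0 <-> val F \in @coboundary R k P N i.
Proof.
exists (quotmod_pi (submod_trace (@coboundary R k P N i))).
split=> [x|F]; first exact: quotmod_pi_surj.
exact: quotmod_eq0.
Qed.

Lemma cocycle_class (f : cochain i N) : cocycle_map f ->
  exists F : Z, forall y, val F y = f y.
Proof.
move=> fd.
have h : (f : 'rV[R]_(res_rank P i) -> N) \in @cocycle R k P N i.
  by apply/asboolP; split=> //; apply: linearP.
by exists (SubmodOf h).
Qed.

Lemma class_cocycle (F : Z) :
  exists f : cochain i N, cocycle_map f /\ forall y, val F y = f y.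
Proof.
have /asboolP[/bundle_linear[f fE] fd] := valP F.
by exists f; split=> x; rewrite fE ?fd.
Qed.

Lemma coboundaryP (F : Z) (f : cochain i N) : (forall y, val F y = f y) ->
  val F \in @coboundary R k P N i <-> coboundary_map f.
Proof.
move=> /funext; move: (val F) => {}F ->.
case: (i) f => [|j] f; split=> [/asboolP h|h].
- by move=> x; rewrite h.
- by apply/asboolP/funext.
- have [g [/bundle_linear[g' g'E] fE]] := h.
  by exists g' => x; rewrite g'E fE.
- have [g gE] := h; apply/asboolP; exists g; split; first exact: linearP.
  exact/funext.
Qed.

Lemma residue_rank0_ext (m : idealr R) :
  residue_rank m (Ext P N i) 0 -> ext_zero i N.
Proof.
move=> [_ [e [eP _]]] f /cocycle_class[F FE].
have [cls [_ clsE]] := ext_projection.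
apply/(coboundaryP FE)/clsE; have [a ->] := eP (cls F).
by rewrite big_ord0.
Qed.

Lemma residue_rank1_ext (m : idealr R) :
  residue_rank m (Ext P N i) 1 -> ~ ext_zero i N /\ ext_rank_le1 m i N.
Proof.
move=> [mE [e [eP eI]]]; have [cls [clsS clsE]] := ext_projection.
split=> [Z0|f g fc gc].
  have [F Fe] := clsS (e ord0); have [f [fc FE]] := class_cocycle F.
  have /(coboundaryP FE)/clsE e0 := Z0 f fc.
  have := eI (fun=> 1); rewrite big_ord1 scale1r -Fe e0.
  by move=> /(_ erefl ord0); rewrite idealr1.
have [F FE] := cocycle_class fc; have [G GE] := cocycle_class gc.
have [a aE] := eP (cls F); have [b bE] := eP (cls G).
move: aE bE; rewrite !big_ord1; move: (a ord0) (b ord0) => {}a {}b aE bE.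
have [am|am] := boolP (a \in m).
  have [h hE] := linear_combination 1 f \0.
  exists 1, 0, h; split; [by left; rewrite idealr1|by move=> x; rewrite hE scale0r|].
  apply: (@coboundary_map_eq _ _ f); first by move=> x; rewrite hE scale1r addr0.
  by apply/(coboundaryP FE)/clsE; rewrite aE mE.
have [h1 h1E] := linear_combination (- a) g \0.
have [h hE] := linear_combination b f h1.
exists b, (- a), h; split; [by right; rewrite rpredN|by move=> x; rewrite hE h1E addr0|].
have HE y : val (b *: F + ((- a) *: G + 0)) y = h y.
  by rewrite hE h1E -FE -GE.
apply/(coboundaryP HE)/clsE; rewrite addr0 linearD !linearZZ aE bE !scalerA.
by rewrite mulNr [b * a]mulrC scaleNr subrr.
Qed.

End FromExt.

(** Multiplication by a on P is null-homotopic, being zero on k. *)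
Lemma ext_killed N i (a : R) (f : cochain i N) :
  (forall x : k, a *: x = 0) -> cocycle_map f ->
  exists g : cochain i N, (forall x, g x = a *: f x) /\ coboundary_map g.
Proof.
move=> ak fc.
have [g gE] := linear_combination a f \0; exists g.
have {}gE x : g x = a *: f x by rewrite gE addr0.
split=> //.
have scale n : exists s : {linear 'rV[R]_n -> 'rV[R]_n}, forall x, s x = a *: x.
  by have [s sE] := @linear_combination R 'rV[R]_n 'rV[R]_n a idfun \0;
     exists s => x; rewrite sE addr0.
have homotopy j : exists h : {linear 'rV[R]_(res_rank P j) -> 'rV[R]_(res_rank P j.+1)},
    forall x, res_diff P j (a *: x - h (res_diff P j x)) = 0.
  elim: j => [|j [h hE]].
    have [s sE] := scale (res_rank P 0).
    have [|h hE] := lift_free (p := res_diff P 0) (f := s).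
      by move=> x; apply/res_exact0; rewrite sE linearZZ ak.
    by exists h => x; rewrite linearB linearZZ hE sE subrr.
  have [s sE] := scale (res_rank P j.+1).
  have [t tE] := linear_combination (-1) (h \o res_diff P j) s.
  have [|h' h'E] := lift_free (p := res_diff P j.+1) (f := t).
    by move=> x; apply/res_exactS; rewrite tE sE scaleN1r addrC hE.
  exists h' => x; rewrite linearB linearZZ h'E tE sE /= diff_diff linear0.
  by rewrite scaler0 add0r subrr.
case: i f g fc gE => [|i] f g fc gE /=.
  move=> x; rewrite gE -linearZZ.
  by have /res_exact0[y <-] : res_aug P (a *: x) = 0 by rewrite linearZZ ak.
have [h hE] := homotopy i; exists (f \o h) => x; rewrite gE -linearZZ /=.
have /res_exactS[y yE] := hE x; apply/eqP.
by rewrite -subr_eq0 -linearB -yE fc.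
Qed.

Lemma ext_zero_injective i E : injective_module E -> ext_zero i.+1 E.
Proof.
move=> Einj f fc.
have [||g gP] := @injective_extend R E _
  (fun p => exists x, p = (res_diff P i x, f x)) Einj.
- split=> [|a _ _ [x ->] [y ->]]; first by exists 0; rewrite !linear0.
  by exists (a *: x + y); rewrite !linearP.
- by move=> e [x [/esym/res_exactS[y <-] ->]]; apply: fc.
by exists g => x; apply/esym/gP; exists x.
Qed.

Lemma ext_zero_retract i M N (u : {linear M -> N}) (v : {linear N -> M}) :
  (forall x, v (u x) = x) -> ext_zero i N -> ext_zero i M.
Proof.
move=> vu Z f fc; apply: (@coboundary_map_comp _ _ i v (u \o f)).
  by move=> x /=; rewrite vu.
by apply: Z => x; rewrite /= fc linear0.
Qed.

Section ShortExact.
Context (M' M M'' : lmodType R) (i : {linear M' -> M}) (p : {linear M -> M''}).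
Hypothesis iI : injective i.
Hypothesis pS : forall y, exists x, p x = y.
Hypothesis pE : forall x, p x = 0 <-> exists y, i y = x.

(** Exactness of Ext^(j-1)(k, M'') -> Ext^j(k, M') -> Ext^j(k, M) makes the
    second map injective when the first group is zero. *)
Lemma ext_injective j (f : cochain j M') (f' : cochain j M) :
  (forall x, f' x = i (f x)) -> cocycle_map f -> coboundary_map f' ->
  (forall l, j = l.+1 -> ext_zero l M'') -> coboundary_map f.
Proof.
case: j f f' => [|j] f f' f'E fc /=; first by move=> f0 _ x; apply: iI; rewrite -f'E f0 linear0.
move=> [g gE] /(_ j erefl) Z.
suff [g' g'0 g'E] : exists2 g' : cochain j M,
    forall x, p (g' x) = 0 & forall x, f' x = g' (res_diff P j x).
  have [|h hE] := @lift_injection R _ _ _ i g' iI; first by move=> x; apply/pE/g'0.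
  by exists h => x; apply: iI; rewrite hE -g'E f'E.
have pg x : p (g (res_diff P j x)) = 0 by apply/pE; exists (f x); rewrite -f'E gE.
suff [g' g'0 g'E] : exists2 g' : cochain j M, forall x, p (g' x) = 0 &
    forall x, g (res_diff P j x) = g' (res_diff P j x).
  by exists g' => // x; rewrite gE g'E.
case: j g pg Z {f f' f'E fc gE} => [|l] g pg /(_ (p \o g) pg) Z.
  by exists g.
have [h hE] := Z; have [h' h'E] := lift_free (fun x => pS (h x)).
have [g' g'E] := linear_combination (-1) (h' \o res_diff P l) g.
exists g' => x; rewrite g'E.
  by rewrite scaleN1r linearD linearN /= h'E -hE addNr.
by rewrite /= diff_diff linear0 scaler0 add0r.
Qed.

Lemma ext_zero_sub j : ext_zero j M ->
  (forall l, j = l.+1 -> ext_zero l M'') -> ext_zero j M'.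
Proof.
move=> Z Z'' f fc; apply: (@ext_injective j f (i \o f)) => //.
by apply: Z => x; rewrite /= fc linear0.
Qed.

(** f' represents the image of f under Ext^j(k, M'') -> Ext^(j+1)(k, M'). *)
Definition connecting j (f : cochain j M'') (f' : cochain j.+1 M') :=
  exists g : cochain j M, (forall x, p (g x) = f x) /\
    forall x, i (f' x) = g (res_diff P j x).

Lemma connecting_exists j (f : cochain j M'') : cocycle_map f ->
  exists f', connecting f f' /\ cocycle_map f'.
Proof.
move=> fc; have [g gE] := lift_free (fun x => pS (f x)).
have [|f' f'E] := @lift_injection R _ _ _ i (g \o res_diff P j) iI.
  by move=> x; apply/pE; rewrite /= gE fc.
exists f'; split; first by exists g.
by move=> x; apply: iI; rewrite f'E /= diff_diff !linear0.
Qed.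

Lemma connecting_injective j (f : cochain j M'') f' :
  connecting f f' -> coboundary_map f' -> ext_zero j M -> coboundary_map f.
Proof.
move=> [g [gE gf']] [h hE] Z.
have [g' g'E] := linear_combination (-1) (i \o h) g.
apply: (@coboundary_map_comp _ _ j p g').
  move=> x; rewrite g'E linearD linearZZ gE /=.
  have -> : p (i (h x)) = 0 by apply/pE; exists (h x).
  by rewrite scaler0 add0r.
by apply: Z => x; rewrite g'E /= -gf' -hE scaleN1r addNr.
Qed.

Lemma ext_zero_quot j : ext_zero j M -> ext_zero j.+1 M' -> ext_zero j M''.
Proof.
move=> Z Z' f /connecting_exists[f' [ff' f'c]].
exact: connecting_injective ff' (Z' f' f'c) Z.
Qed.

Lemma ext_rank_quot (m : idealr R) j :
  ext_zero j M -> ext_rank_le1 m j.+1 M' -> ext_rank_le1 m j M''.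
Proof.
move=> Z r f1 f2 /connecting_exists[f1' [[g1 [g1E g1f]] c1]].
move=> /connecting_exists[f2' [[g2 [g2E g2f]] c2]].
have [a [b [h' [ab h'E h'b]]]] := r _ _ c1 c2.
have [t tE] := linear_combination b f2 \0.
have [h hE] := linear_combination a f1 t.
exists a, b, h; split=> // [x|]; first by rewrite hE tE addr0.
apply: connecting_injective Z => //; last exact: h'b.
have [s sE] := linear_combination b g2 \0.
have [g gE] := linear_combination a g1 s.
exists g; split=> x; rewrite ?gE ?sE ?hE ?tE !addr0.
  by rewrite linearD !linearZZ g1E g2E.
by rewrite h'E linearD !linearZZ g1f g2f.
Qed.

End ShortExact.

(** Ext^(i+1)(k, C_(j+1)) = Ext^(i+2)(k, C_j), since Ext^n(k, I_j) = 0 for n > 0. *)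
Lemma ext_zero_cosyz (T : cosyzygies R) i j :
  ext_zero (j + i).+1 (cosyz T 0) -> ext_zero i.+1 (cosyz T j).
Proof.
elim: j i => [//|j IH] i; rewrite addSnnS => /IH.
apply: (ext_zero_quot (@cosyz_in_inj _ T j) (@cosyz_out_surj _ T j) (@cosyz_exact _ T j)).
exact/ext_zero_injective/hull_injective.
Qed.

Lemma coboundary_row i n (f : cochain i 'rV[R]_n) :
  (forall t, exists2 g : cochain i R^o, (forall x, g x = f x 0 t) & coboundary_map g) ->
  coboundary_map f.
Proof.
case: i f => [|i] f /= fb.
  by move=> x; apply/rowP => t; have [g <- ->] := fb t; rewrite mxE.
have {}fb t : exists h : cochain i R^o, forall x, f x 0 t = h (res_diff P i x).
  by have [g gE [h hE]] := fb t; exists h => x; rewrite -gE.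
have [h hE] := choice fb.
have [|g gE] := @bundle_linear R _ 'rV[R]_n (fun x => \row_t h t x).
  by move=> a x y; apply/rowP => t; rewrite !mxE linearP.
by exists g => x; apply/rowP => t; rewrite gE mxE.
Qed.

Lemma coordinate n (t : 'I_n) :
  exists c : {linear 'rV[R]_n -> R^o}, forall x, c x = x 0 t.
Proof. by apply: bundle_linear => a x y; rewrite !mxE. Qed.

Lemma ext_zero_row i n : ext_zero i R^o -> ext_zero i 'rV[R]_n.
Proof.
move=> Z f fc; apply: coboundary_row => t; have [c cE] := coordinate t.
exists (c \o f); first by move=> x; rewrite /= cE.
by apply: Z => x; rewrite /= fc linear0.
Qed.

End ExtZero.

(** Both sides say that Ext^(j+1)(k, C_0) = 0, the first through P and the
    second through the cosyzygies; they are compared at Ext^1(k, C_j). *)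
Lemma ext_zero_lifts (R : comNzRingType) (m : idealr R) (P : free_resolution (residue_field m))
    (T : cosyzygies R) j :
  ext_zero P j.+1 (cosyz T 0) -> lifts T j (fun a => a \in m).
Proof.
move=> Z c mc.
have {Z} Z : ext_zero P 1 (cosyz T j) by apply: ext_zero_cosyz; rewrite addn0.
have [u uE] := @cyclic_map R (ideal_submod m) _ c mc.
have aug0 x : res_aug P (res_diff P 0 x) = 0 by apply/res_exact0; exists x.
have [|f' [[g [gE gf']] f'c]] := connecting_exists (@cosyz_in_inj _ T j)
  (@cosyz_out_surj _ T j) (@cosyz_exact _ T j)
  (f := u \o res_aug P : {linear 'rV[R]_(res_rank P 0) -> _}).
  by move=> x; rewrite /= aug0 linear0.
have [h hE] := Z f' f'c.
have [g' g'E] := linear_combination (-1) (cosyz_in T j \o h) g.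
have [|w wE] := factor_surjection (p := res_aug P) (f := g') (@res_surj _ _ P).
  move=> x /res_exact0[y <-]; rewrite g'E /= -hE gf' scaleN1r.
  exact: addNr.
pose one : residue_field m := quotmod_pi _ 1.
have oneE (a : R^o) : quotmod_pi (ideal_submod m) a = a *: one.
  by rewrite -linearZ [_ *: _]mulr1.
exists (w one); split; last first.
  move=> a am; rewrite -linearZZ -oneE.
  suff -> : quotmod_pi (ideal_submod m) a = 0 by rewrite linear0.
  exact/quotmod_eq0.
have [x xE] := res_surj P one.
rewrite -xE wE g'E linearD linearZZ gE /= xE uE scale1r.
have -> : cosyz_out T j (cosyz_in T j (h x)) = 0 by apply/cosyz_exact; exists (h x).
by rewrite scaler0 add0r.
Qed.

(** * Regular sequences *)

Section RegularElement.
Context {R : comNzRingType} (hR : noetherian R) (m : idealr R) (hm : local_ring m).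
Context (M : lmodType R) (fgM : fg_module M).

Section Powers.
Context (L : M -> Prop) (hL : submodule L) (x z : R) (zm : z \in m).
Hypothesis xL : forall y, L y -> x *: y = 0 -> y = 0.

Let a n := x + z ^+ n.+1.

Fixpoint torsion_sum n (u : M) : Prop :=
  if n is n'.+1 then exists v w, [/\ torsion_sum n' v, L w, a n' *: w = 0 & u = v + w]
  else u = 0.

Lemma torsion_sum_submodule n : submodule (torsion_sum n).
Proof.
elim: n => [|n [IH0 IH]]; split=> //=.
- by move=> b u v -> ->; rewrite scaler0 addr0.
- by exists 0, 0; split; rewrite ?scaler0 ?addr0 //; apply: sub0.
move=> b _ _ [v [w [Dv Lw aw ->]]] [v' [w' [Dv' Lw' aw' ->]]].
exists (b *: v + v'), (b *: w + w'); split; [exact: IH|exact: hL.2| |].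
  by rewrite scalerDr scalerA mulrC -scalerA aw aw' scaler0 addr0.
by rewrite scalerDr addrACA.
Qed.

Lemma torsion_sumL n u : torsion_sum n u -> L u.
Proof.
elim: n u => [|n IH] u /=; first by move->; apply: sub0.
by move=> [v [w [/IH Lv Lw _ ->]]]; apply: subD.
Qed.

Lemma torsion_independent n j u :
  (n <= j)%N -> torsion_sum n u -> a j *: u = 0 -> u = 0.
Proof.
elim: n j u => [//|n IH] j u nj Du aju.
have [v [w [Dv Lw anw uE]]] := Du.
(* The elements killed by a_j and by a_n differ by powers of z. *)
have anv : a n *: v = (a n - a j) *: u.
  by rewrite scalerBl aju subr0 uE scalerDr anw addr0.
have anv0 : a n *: v = 0.
  apply: (IH j); [exact: ltnW|exact: subZ (torsion_sum_submodule n) Dv|].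
  by rewrite anv scalerA mulrC -scalerA aju scaler0.
have [b bE] : exists b, b * (1 - z ^+ (j - n)) = 1.
  apply: (local_unit1B hR hm); move: nj; rewrite -subn_gt0.
  by case: (j - n)%N => // l _; rewrite exprSr; apply: idealMr.
have zu : z ^+ n.+1 *: u = 0.
  have : b *: ((a n - a j) *: u) = 0 by rewrite -anv anv0 scaler0.
  have -> : a n - a j = (1 - z ^+ (j - n)) * z ^+ n.+1.
    rewrite mulrBl mul1r -exprD addnS subnK; last exact: ltnW.
    by rewrite /a opprD addrACA subrr add0r.
  by rewrite scalerA mulrA bE mul1r.
apply: xL; first exact: torsion_sumL Du.
move: aju; rewrite /a scalerDl.
have -> : z ^+ j.+1 *: u = 0.
  by rewrite -(subnK (leqW nj)) addnC exprD mulrC -scalerA zu scaler0.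
by rewrite addr0.
Qed.

(** The submodules of L killed by the elements x + z^n are independent by the
    previous lemma. Were they all nonzero, their sums would form an infinite
    strictly increasing sequence. *)
Lemma regular_perturbation : exists n, forall y, L y -> (x + z ^+ n.+1) *: y = 0 -> y = 0.
Proof.
apply: contrapT => none.
have [||S [[n SE] Smax]] := @maximal_submodule R hR M
  (fun S => exists n, S = torsion_sum n) (torsion_sum 0) fgM.
- by move=> _ [n ->]; apply: torsion_sum_submodule.
- by exists 0%N.
apply: none; exists n => y Ly ay; apply: (torsion_independent (leqnn n)) => //.
rewrite -SE; apply: (Smax (torsion_sum n.+1)); first by exists n.+1.
  move=> u; rewrite SE => Du; exists u, 0; rewrite scaler0 addr0.
  by split=> //; apply: sub0.
by exists 0, y; rewrite add0r; split=> //; apply: sub0 (torsion_sum_submodule n).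
Qed.

End Powers.

(** Let L be maximal among the submodules on which some x in m is regular. If x
    kills some nonzero y, then Ry meets L in 0, and y may be taken such that
    ann(y) is a prime, which differs from m. A power of some z in m outside this
    prime, added to x, then gives an element that is regular on L + Ry. *)
Lemma regular_element :
  (forall y : M, (forall a, a \in m -> a *: y = 0) -> y = 0) ->
  exists x, x \in m /\ forall y : M, x *: y = 0 -> y = 0.
Proof.
move=> soc0.
have [||L [[hL [x [xm xL]]] Lmax]] := @maximal_submodule R hR M
  (fun L => submodule L /\ exists x, x \in m /\ forall y, L y -> x *: y = 0 -> y = 0)
  (fun y => y = 0) fgM.
- by move=> S [].
- split; last by exists 0; rewrite idealr0.
  by split=> // a _ _ -> ->; rewrite scaler0 addr0.
exists x; split=> // y0 xy0; apply: contrapT => y0n0.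
(* Among the nonzero elements killed by x, choose y with maximal annihilator. *)
pose ann (y : M) := fun a : R^o => a *: y = 0.
have [||_ [[y [yn0 xy ->]] ymax]] := @maximal_submodule R hR R^o
  (fun I => exists y, [/\ y <> 0, x *: y = 0 & I = ann y]) (ann y0) (@ring_fg R).
- move=> _ [y [_ _ ->]]; split=> [|a b c]; rewrite /ann ?scale0r // => by0 cy0.
  by rewrite scalerDl -scalerA by0 cy0 scaler0 addr0.
- by exists y0.
have yprime a : a *: y <> 0 -> forall b, b *: (a *: y) = 0 -> b *: y = 0.
  move=> ay b bay; apply: (ymax (ann (a *: y))) => //.
    by exists (a *: y); split=> //; rewrite scalerA mulrC -scalerA xy scaler0.
  by move=> c; rewrite /ann => cy; rewrite scalerA mulrC -scalerA cy scaler0.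
have kx b : x *: (b *: y) = 0.
  by rewrite scalerA mulrC -scalerA xy scaler0.
have [z [zm zy]] : exists z, z \in m /\ z *: y <> 0.
  apply: contrapT => nz; apply/yn0/soc0 => a am.
  by apply: contrapT => ay; apply: nz; exists a.
have zny n : z ^+ n *: y <> 0.
  elim: n => [|n IH]; first by rewrite scale1r.
  by rewrite exprS -scalerA => /(yprime _ IH).
have [n nreg] := regular_perturbation hL zm xL.
have yL a : L (a *: y) -> a *: y = 0.
  by move=> La; apply: xL.
apply: yn0; rewrite -[y]scale1r; apply: yL.
apply: (Lmax (fun u => exists l a, L l /\ u = l + a *: y)).
- split.
    split=> [|r _ _ [l [a [Ll ->]]] [l' [a' [Ll' ->]]]].
      by exists 0, 0; rewrite scale0r addr0; split=> //; apply: sub0.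
    exists (r *: l + l'), (r * a + a'); split; first exact: hL.2.
    by rewrite scalerDr scalerDl addrACA scalerA.
  exists (x + z ^+ n.+1); split.
    apply: (subD (maximal_sub m)) => //; rewrite exprSr.
    exact: idealMr.
  move=> _ [l [a [Ll ->]]]; rewrite scalerDr => e.
  have e' : (x + z ^+ n.+1) *: (a *: y) = a *: (z ^+ n.+1 *: y).
    by rewrite scalerDl kx add0r !scalerA mulrC.
  have wl0 : (x + z ^+ n.+1) *: l = 0.
    apply: xL; first exact: subZ.
    move: e; rewrite e' => /eqP; rewrite addr_eq0 => /eqP ->.
    by rewrite scalerN [a *: _]scalerA kx oppr0.
  have l0 := nreg l Ll wl0; move: e; rewrite l0 scaler0 add0r e' add0r.
  exact: yprime (zny n.+1) a.
- by move=> l Ll; exists l, 0; rewrite scale0r addr0.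
by exists 0, 1; rewrite add0r; split=> //; apply: sub0.
Qed.

End RegularElement.

Section RegularSequence.
Context {R : comNzRingType}.
Implicit Types (M N : lmodType R) (t : seq R).

(** The submodule tM. The last element of a regular sequence is the head of t,
    which is why sequences are reversed in depth_regular. *)
Fixpoint smul t M (y : M) : Prop :=
  if t is x :: t' then exists z w, smul t' w /\ y = x *: z + w else y = 0.

Fixpoint regular t M : Prop :=
  if t is x :: t' then regular t' M /\ forall y : M, smul t' (x *: y) -> smul t' y
  else True.

Lemma smul_submodule t M : submodule (@smul t M).
Proof.
elim: t => [|x t [IH0 IH]]; split=> //=.
- by move=> a y z -> ->; rewrite scaler0 addr0.
- by exists 0, 0; rewrite scaler0 addr0.
- move=> a _ _ [z [w [tw ->]]] [z' [w' [tw' ->]]].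
  exists (a *: z + z'), (a *: w + w'); split; first exact: IH.
  by rewrite !scalerDr !scalerA [a * x]mulrC addrACA.
Qed.

Lemma smul_linear t M N (u : {linear M -> N}) y : smul t y -> smul t (u y).
Proof.
elim: t y => [|x t IH] y /=; first by move->; rewrite linear0.
by move=> [z [w [/IH tw ->]]]; exists (u z), (u w); rewrite linearD linearZZ.
Qed.

Lemma smul_pair t M N (y : (M * N)%type) : smul t y <-> smul t y.1 /\ smul t y.2.
Proof.
elim: t y => [|x t IH] [y1 y2] /=; first by split=> [[-> ->]|[-> ->]].
split=> [[[z1 z2] [[w1 w2] [/IH[/= tw1 tw2] [-> ->]]]]|].
  by split; [exists z1, w1|exists z2, w2].
move=> [[z1 [w1 [tw1 ->]]] [z2 [w2 [tw2 ->]]]].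
by exists (z1, z2), (w1, w2); split=> //; apply/IH.
Qed.

Lemma regular_pair t M N : regular t (M * N)%type -> regular t M /\ regular t N.
Proof.
elim: t => [//|x t IH] [/IH[tM tN] tx]; split; split=> // y txy.
  have /smul_pair[//] : smul t ((y, 0) : (M * N)%type).
  apply: tx; apply/smul_pair; split=> //=; rewrite scaler0.
  exact: sub0 (smul_submodule _ _).
have /smul_pair[//] : smul t ((0, y) : (M * N)%type).
apply: tx; apply/smul_pair; split=> //=; rewrite scaler0.
exact: sub0 (smul_submodule _ _).
Qed.

Lemma smul_ideal t M (a : R^o) (y : M) : smul t a -> smul t (a *: y).
Proof.
move=> ta; have [f fE] : exists f : {linear R^o -> M}, forall b, f b = b *: y.
  by apply: bundle_linear => b c d; rewrite scalerDl scalerA.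
by rewrite -fE; apply: smul_linear.
Qed.

Lemma smul_span t (a : R^o) : smul t a <-> span (t : seq R^o) a.
Proof.
elim: t a => [//|x t IH] a /=; split=> -[z [w [/IH tw ->]]].
  by exists z, w; split=> //; congr (_ + _); apply: mulrC.
by exists z, w; split=> //; congr (_ + _); apply: mulrC.
Qed.

Lemma smul_maximal (m : idealr R) t (a : R^o) :
  {subset t <= m} -> smul t a -> a \in m.
Proof.
move=> tm /smul_span; apply: (span_least (maximal_sub m)); exact: tm.
Qed.

Section Quotient.
Context (M : lmodType R).

Definition seq_quotient t : lmodType R := quotmod (bundle (smul_submodule t M)).

Definition seq_proj t : {linear M -> seq_quotient t} :=
  quotmod_pi (bundle (smul_submodule t M)).

Lemma seq_proj_surj t y : exists x, seq_proj t x = y.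
Proof. exact: quotmod_pi_surj. Qed.

Lemma seq_proj_eq0 t y : seq_proj t y = 0 <-> smul t y.
Proof.
split=> [/quotmod_eq0/bundleP //|h]; exact/quotmod_eq0/bundleP.
Qed.

(** 0 -> M/tM -> M/tM -> M/(x, t)M -> 0, where the first map is x. *)
Lemma seq_quotient_exact x t : regular (x :: t) M ->
  exists (i : {linear seq_quotient t -> seq_quotient t})
         (p : {linear seq_quotient t -> seq_quotient (x :: t)}),
    [/\ forall y, i y = x *: y, injective i, forall y, exists z, p z = y &
        forall y, p y = 0 <-> exists z, i z = y].
Proof.
move=> [_ tx].
have [i iE] : exists i : {linear seq_quotient t -> seq_quotient t}, forall y, i y = x *: y.
  by apply: bundle_linear => a y z; rewrite scalerDr !scalerA mulrC.
have [|p pE] := factor_surjection (f := seq_proj (x :: t)) (@seq_proj_surj t).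
  move=> y /seq_proj_eq0 ty; apply/seq_proj_eq0.
  by exists 0, y; rewrite scaler0 add0r.
exists i, p; split=> // [y z|y|y].
- rewrite !iE => /eqP; rewrite -subr_eq0 -scalerBr => h.
  apply/eqP; rewrite -subr_eq0; move: h.
  have [w <-] := seq_proj_surj (y - z); rewrite -linearZZ => /eqP/seq_proj_eq0/tx h.
  exact/eqP/seq_proj_eq0.
- by have [z <-] := seq_proj_surj y; exists (seq_proj t z).
have [z <-] := seq_proj_surj y; rewrite pE; split.
  move=> /seq_proj_eq0[u [w [tw ->]]]; exists (seq_proj t u).
  rewrite iE linearD linearZZ; have -> : seq_proj t w = 0 by apply/seq_proj_eq0.
  by rewrite addr0.
move=> [u]; have [v <-] := seq_proj_surj u; rewrite iE -linearZZ => e.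
rewrite -pE -e pE; apply/seq_proj_eq0; exists v, 0; rewrite addr0.
by split=> //; apply: sub0 (smul_submodule _ _).
Qed.

End Quotient.

Lemma seq_quotient_fg t M : fg_module M -> fg_module (seq_quotient M t).
Proof.
move=> [l lP]; exists [seq seq_proj M t y | y <- l] => x.
have [y <-] := seq_proj_surj x; elim: l y {lP} (lP y) => [|g l IH] y /=.
  by move->; rewrite linear0.
move=> [a [w [lw ->]]]; exists a, (seq_proj M t w).
by rewrite linearD linearZZ; split=> //; apply: IH.
Qed.

Section ExtOfQuotient.
Context {k : lmodType R} (P : free_resolution k) (m : idealr R).
Hypothesis mk : forall a (x : k), a \in m -> a *: x = 0.

Lemma ext_zero_quotient n t M : regular t M ->
  (forall i, (i <= n + size t)%N -> ext_zero P i M) ->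
  forall i, (i <= n)%N -> ext_zero P i (seq_quotient M t).
Proof.
elim: t n => [|x t IH] n.
  move=> _ Z i; rewrite -[n]addn0 => /Z.
  have [|u uE] := factor_surjection (f := idfun) (@seq_proj_surj M [::]).
    by move=> y /seq_proj_eq0.
  apply: (@ext_zero_retract _ _ _ _ _ _ u (seq_proj M [::])) => y.
  by have [z <-] := seq_proj_surj y; rewrite uE.
move=> tx Z i ni; have [u [p [_ uI pS pE]]] := seq_quotient_exact tx.
have Zt l : (l <= n.+1)%N -> ext_zero P l (seq_quotient M t).
  by apply: IH tx.1 _ l => l ln; apply: Z; rewrite addnS -addSn.
exact: (ext_zero_quot uI pS pE (Zt i (leqW ni)) (Zt i.+1 ni)).
Qed.

(** Ext^i(k, M/tM) embeds by x into itself when Ext^(i-1)(k, M/(x, t)M) = 0, and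
    x kills it. *)
Lemma ext_zero_regular n t M : {subset t <= m} -> regular t M ->
  (forall i, (i < n)%N -> ext_zero P i (seq_quotient M t)) ->
  forall i, (i < n + size t)%N -> ext_zero P i M.
Proof.
elim: t n => [|x t IH] n tm.
  move=> _ Z i; rewrite addn0 => /Z.
  have [|u uE] := factor_surjection (f := idfun) (@seq_proj_surj M [::]).
    by move=> y /seq_proj_eq0.
  by apply: (@ext_zero_retract _ _ _ _ _ _ (seq_proj M [::]) u) => y; rewrite uE.
move=> tx Z; have [u [p [uE uI pS pE]]] := seq_quotient_exact tx.
rewrite addnS -addSn; apply: IH tx.1 _.
  by move=> y yt; apply: tm; rewrite in_cons yt orbT.
move=> i ni f fc.
have [g [gE gb]] := ext_killed (P := P) (fun y => mk y (tm x (mem_head _ _))) fc.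
apply: (ext_injective uI pS pE (f' := g)) => //; first by move=> y; rewrite gE uE.
by move=> l il; apply: Z; rewrite -ltnS -il.
Qed.

Lemma ext_rank_quotient j t M : regular t M ->
  (forall i, (i < j + size t)%N -> ext_zero P i M) ->
  ext_rank_le1 P m (j + size t) M -> ext_rank_le1 P m j (seq_quotient M t).
Proof.
elim: t j => [|x t IH] j.
  rewrite addn0 => _ _ r f g fc gc.
  have [|u uE] := factor_surjection (f := idfun) (@seq_proj_surj M [::]).
    by move=> y /seq_proj_eq0.
  have uK y : seq_proj M [::] (u y) = y.
    by have [z <-] := seq_proj_surj y; rewrite uE.
  have [||a [b [h [ab hE hb]]]] := r (u \o f) (u \o g).
  - by move=> y; rewrite /= fc linear0.
  - by move=> y; rewrite /= gc linear0.
  exists a, b, (seq_proj M [::] \o h); split=> // [y|].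
    by rewrite /= hE linearD !linearZZ /= !uK.
  exact: (coboundary_map_comp (u := seq_proj M [::]) _ hb).
move=> tx Z; rewrite /= addnS -addSn => r.
have [u [p [_ uI pS pE]]] := seq_quotient_exact tx.
apply: (ext_rank_quot uI pS pE).
  apply: (ext_zero_quotient tx.1 _ (leqnn j)) => i ij.
  by apply: Z; rewrite /= addnS ltnS.
by apply: IH tx.1 _ r => i; rewrite addSn -addnS; apply: Z.
Qed.

End ExtOfQuotient.

Section Socle.
Context (m : idealr R) (P : free_resolution (residue_field m)).

Lemma residue_killed a (x : residue_field m) : a \in m -> a *: x = 0.
Proof.
move=> am; have [b <-] := quotmod_pi_surj x; rewrite -linearZ.
apply/quotmod_eq0; rewrite [_ *: _]mulrC; exact: (idealMr b am).
Qed.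

Lemma socle_cocycle N (y : N) : (forall a, a \in m -> a *: y = 0) ->
  exists u : {linear residue_field m -> N}, u (quotmod_pi _ 1) = y /\
    cocycle_map (u \o res_aug P : {linear 'rV[R]_(res_rank P 0) -> N}).
Proof.
move=> my; have [u uE] := @cyclic_map R (ideal_submod m) _ y my.
exists u; rewrite uE scale1r; split=> // x /=.
by have -> : res_aug P (res_diff P 0 x) = 0; [apply/res_exact0; exists x|rewrite linear0].
Qed.

Lemma ext_zero_socle N : ext_zero P 0 N <->
  forall y : N, (forall a, a \in m -> a *: y = 0) -> y = 0.
Proof.
split=> [Z y /socle_cocycle[u [<- uc]]|soc0 f fc].
  by have [x <-] := res_surj P (quotmod_pi _ 1); apply: (Z _ uc).
have [|g gE] := factor_surjection (p := res_aug P) (f := f) (@res_surj _ _ P).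
  by move=> x /res_exact0[y <-]; apply: fc.
move=> x; rewrite -gE; apply: soc0 => a am.
by rewrite -linearZZ residue_killed // linear0.
Qed.

Lemma ext_rank_socle N (y z : N) : ext_rank_le1 P m 0 N ->
  (forall a, a \in m -> a *: y = 0) -> (forall a, a \in m -> a *: z = 0) ->
  exists a b, (a \notin m \/ b \notin m) /\ a *: y + b *: z = 0.
Proof.
move=> r /socle_cocycle[u [<- uc]] /socle_cocycle[v [<- vc]].
have [a [b [h [ab hE h0]]]] := r _ _ uc vc; exists a, b; split=> //.
have [x <-] := res_surj P (quotmod_pi _ 1).
by rewrite -[LHS](hE x) h0.
Qed.

End Socle.

Lemma in_ideal_gen_smul (s : seq R) (y : R) : in_ideal_gen s y <-> smul (rev s) (y : R^o).
Proof.
rewrite smul_span; have le_ (l1 l2 : seq R^o) : l1 =i l2 -> span l1 y -> span l2 y.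
  move=> l12; apply: (span_least (span_submodule l2)) => x; rewrite l12.
  exact: span_mem.
split=> [[c ->]|h].
  apply: (span_least (span_submodule _)) (span_sum (fun i : 'I_(size s) => s`_i : R^o) c).
  move=> _ /codomP[i ->]; apply: span_mem.
  by rewrite mem_rev; apply: mem_nth.
by apply: (span_coef (l := s : seq R^o)); apply: le_ h => x; rewrite mem_rev.
Qed.

Lemma regular_seq_rev (s : seq R) :
  regular (rev s) R^o <-> forall i, (i < size s)%N -> forall a,
     in_ideal_gen (take i s) (s`_i * a) -> in_ideal_gen (take i s) a.
Proof.
elim/last_ind: s => [//|s x IH]; rewrite rev_rcons /=; split.
  move=> [/IH h hx] i; rewrite size_rcons ltnS leq_eqVlt => /orP[/eqP->|si] a.
    rewrite nth_rcons ltnn eqxx -cats1 take_size_cat // => /in_ideal_gen_smul/hx ?.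
    exact/in_ideal_gen_smul.
  by rewrite nth_rcons si -cats1 takel_cat; [apply: h|apply: ltnW].
move=> h; split=> [|y].
  apply/IH => i si a; have := h i; rewrite size_rcons nth_rcons si -cats1 takel_cat.
    by apply; rewrite ltnS ltnW.
  exact: ltnW.
have := h (size s); rewrite size_rcons nth_rcons ltnn eqxx -cats1 take_size_cat //.
by move=> /(_ (ltnSn _) y) + hy => /(_ (iffRL (in_ideal_gen_smul _ _) hy))/in_ideal_gen_smul.
Qed.

Lemma depth_regular (m : idealr R) d : depth m d ->
  (exists t, [/\ size t = d, {subset t <= m} & regular t R^o]) /\
  forall t, {subset t <= m} -> regular t R^o -> (size t <= d)%N.
Proof.
move=> [[s [sd sm [sreg _]]] smax]; split.
  exists (rev s); rewrite size_rev; split=> //; last exact/regular_seq_rev.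
  by move=> x; rewrite mem_rev; apply: sm.
move=> t tm treg; rewrite -size_rev; apply: smax.
  by move=> x; rewrite mem_rev; apply: tm.
split; first by apply/regular_seq_rev; rewrite revK.
move=> /in_ideal_gen_smul; rewrite revK => /(smul_maximal tm).
by rewrite idealr1.
Qed.

End RegularSequence.

Section Depth.
Context {R : comNzRingType} (hR : noetherian R) (m : idealr R) (hm : local_ring m).

Lemma regular_cons t (M : lmodType R) : fg_module M -> regular t M ->
  (forall y : M, (forall a, a \in m -> smul t (a *: y)) -> smul t y) ->
  exists x, x \in m /\ regular (x :: t) M.
Proof.
move=> fgM treg soc0.
have [|x [xm xreg]] := regular_element hR hm (seq_quotient_fg t fgM).
  move=> y; have [z <-] := seq_proj_surj y => mz; apply/seq_proj_eq0/soc0 => a am.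
  by apply/seq_proj_eq0; rewrite linearZZ mz.
exists x; split=> //; split=> // y /seq_proj_eq0.
by rewrite linearZZ => /xreg/seq_proj_eq0.
Qed.

(** Modulo a sequence shorter than d, Ext^0(k, -) still vanishes, which means
    that there is no socle. *)
Lemma regular_exists (P : free_resolution (residue_field m)) (M : lmodType R) d :
  fg_module M -> (forall i, (i < d)%N -> ext_zero P i M) ->
  exists t, [/\ size t = d, {subset t <= m} & regular t M].
Proof.
move=> fgM; elim: d => [|d IH] Z; first by exists [::].
have [|t [td tm treg]] := IH; first by move=> i /leqW; apply: Z.
have [|x [xm xreg]] := regular_cons fgM treg.
  have /ext_zero_socle soc0 : ext_zero P 0 (seq_quotient M t).
    by apply: (ext_zero_quotient treg _ (leqnn 0)) => i; rewrite td => /Z.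
  move=> y my; apply/seq_proj_eq0/soc0 => a am.
  by rewrite -linearZZ; apply/seq_proj_eq0/my.
exists (x :: t); split=> //=; first by rewrite td.
by move=> y; rewrite in_cons => /orP[/eqP->|/tm].
Qed.

(** Otherwise t could be prolonged by an element regular on R/(t). *)
Lemma depth_socle d t : depth m d -> size t = d -> {subset t <= m} -> regular t R^o ->
  exists u : R^o, ~ smul t u /\ forall a, a \in m -> smul t (a *: u).
Proof.
move=> /depth_regular[_ tmax] td tm treg; apply: contrapT => nu.
have [|x [xm xreg]] := regular_cons (@ring_fg R) treg.
  by move=> y my; apply: contrapT => ny; apply: nu; exists y.
suff /tmax/(_ xreg) : {subset x :: t <= m} by rewrite /= td ltnn.
by move=> y; rewrite in_cons => /orP[/eqP->|/tm].
Qed.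

End Depth.

(** * A free summand of a syzygy *)

Section FreeSummand.
Context {R : comNzRingType}.

Lemma free_summand_retract (M : lmodType R) : has_nonzero_free_summand M ->
  exists (u : {linear R^o -> M}) (v : {linear M -> R^o}), forall a, v (u a) = a.
Proof.
move=> [r [X [phi [r0 [psi phiK psiK]]]]].
case: r r0 phi psi phiK psiK => // r _ phi psi phiK psiK.
have [u0 u0E] : exists u0 : {linear R^o -> ('rV[R]_r.+1 * X)%type},
    forall a, u0 a = (a *: delta_mx 0 ord0, 0).
  apply: bundle_linear => a b c; rewrite pair_scaler pair_addr.
  by rewrite scaler0 addr0 scalerDl scalerA.
have [v vE] : exists v : {linear M -> R^o}, forall x, v x = (phi x).1 0 ord0.
  by apply: bundle_linear => a x y; rewrite linearP !mxE.
have [|u uE] := @lift_injection R _ _ _ phi u0 (can_inj phiK).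
  by move=> a; exists (psi (u0 a)).
by exists u, v => a; rewrite vE uE u0E !mxE !eqxx mulr1.
Qed.

Lemma syzygy_exact (M : lmodType R) (F : free_resolution M) n :
  exists (i : {linear syzygy F n.+1 -> 'rV[R]_(res_rank F n)})
         (p : {linear 'rV[R]_(res_rank F n) -> syzygy F n}),
    [/\ injective i, forall y, exists x, p x = y,
        forall x, p x = 0 <-> exists y, i y = x &
        forall y, exists x, i y = res_diff F n x].
Proof.
have [i iE] : exists i : {linear syzygy F n.+1 -> 'rV[R]_(res_rank F n)},
    forall y, i y = val y by apply: bundle_linear.
have iI : injective i by move=> x y; rewrite !iE => /val_inj.
have im x : (exists y, i y = x) <-> exists y, res_diff F n y = x.
  split=> [[y <-]|xE]; first by rewrite iE; have /asboolP := valP y.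
  have h : x \in image_pred (res_diff F n) by apply/asboolP.
  by exists (SubmodOf h); rewrite iE.
exists i; have iD y : exists x, i y = res_diff F n x.
  by have [|x xE] := iffLR (im (i y)); [exists y|exists x].
case: n i iE iI im iD => [|n] i iE iI im iD.
  exists (res_aug F); split=> // [|x]; first exact: res_surj.
  by rewrite im; apply: res_exact0.
have lift x : exists y : image_mod (res_diff F n), val y = res_diff F n x.
  have h : res_diff F n x \in image_pred (res_diff F n) by apply/asboolP; exists x.
  by exists (SubmodOf h).
have [p pE] := choice lift.
have [|p' p'E] := @bundle_linear R _ (image_mod (res_diff F n)) p.
  by move=> a x y; apply: val_inj; rewrite pE linearP /= !pE.
exists p'; split=> // [y|x].
  have /asboolP[x xE] := valP y.
  by exists x; apply: val_inj; rewrite p'E pE xE.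
rewrite im -res_exactS p'E -pE; split=> [->//|h].
by apply: val_inj; rewrite h.
Qed.

Context (hR : noetherian R) (m : idealr R) (hm : local_ring m).
Context (P : free_resolution (residue_field m)) (d : nat) (hd : depth m d).

Lemma ext_zero_ring i : (i < d)%N -> ext_zero P i R^o.
Proof.
have [[t [td tm treg]] _] := depth_regular hd; rewrite -td => id.
by apply: (ext_zero_regular (n := 0) (@residue_killed _ m) tm treg).
Qed.

Lemma ext_ring_depth : ~ ext_zero P d R^o.
Proof.
move=> Zd; have [[t [td tm treg]] _] := depth_regular hd.
have /ext_zero_socle soc0 : ext_zero P 0 (seq_quotient R^o t).
  apply: (ext_zero_quotient treg _ (leqnn 0)) => i; rewrite add0n td leq_eqVlt.
  by move=> /orP[/eqP->|/ext_zero_ring].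
have [u [nu mu]] := depth_socle hR hm hd td tm treg.
apply/nu/seq_proj_eq0/soc0 => a am.
by rewrite -linearZZ; apply/seq_proj_eq0/mu.
Qed.

Lemma ext_zero_syzygy (M : lmodType R) (F : free_resolution M) n :
  (forall i, (i < d)%N -> ext_zero P i M) ->
  forall i, (i < d)%N -> ext_zero P i (syzygy F n).
Proof.
move=> Z; elim: n => // n IH i id; have [u [p [uI pS pE _]]] := syzygy_exact F n.
apply: (ext_zero_sub uI pS pE); first exact/ext_zero_row/ext_zero_ring.
by move=> l il; apply: IH; rewrite -il ltnW // il.
Qed.

(** A free summand R of a syzygy lies in mF, so R -> F induces zero on
    Ext^d(k, -); but Ext^d(k, Omega) -> Ext^d(k, F) is injective because the
    previous syzygy has depth at least d. Hence Ext^d(k, R) = 0, contrary to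
    depth R = d. *)
Lemma no_free_summand (M : lmodType R) (F : free_resolution M) n :
  (forall i, (i < d)%N -> ext_zero P i M) -> minimal_resolution m F ->
  ~ has_nonzero_free_summand (syzygy F n.+1).
Proof.
move=> Z Fmin /free_summand_retract[u [v vu]]; apply: ext_ring_depth => f fc.
have [i [p [iI pS pE iD]]] := syzygy_exact F n.
apply: (coboundary_map_comp (u := v) (f := u \o f)) => [x|]; first by rewrite /= vu.
apply: (ext_injective iI pS pE (f' := i \o (u \o f))) => //.
- by move=> x; rewrite /= fc !linear0.
- apply: coboundary_row => t.
  have [x xE] := iD (u 1).
  have [g [gE gb]] := ext_killed (fun y => residue_killed y (Fmin n x t)) fc.
  exists g => // y; rewrite gE /=.
  have -> : u (f y) = f y *: u 1.
    rewrite -linearZZ; congr (u _); exact/esym/mulr1.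
  have -> : i (f y *: u 1) = f y *: i (u 1) by apply: linearZ.
  by rewrite xE mxE; apply: mulrC.
- by move=> l ld; apply: ext_zero_syzygy => //; rewrite ld.
Qed.

End FreeSummand.

(** * Gorenstein rings and Ext *)

Section Gorenstein.
Context {R : comNzRingType} (hR : noetherian R) (m : idealr R) (hm : local_ring m).
Context (P : free_resolution (residue_field m)).

Lemma ext_zero_cosyz_injective (M : lmodType R) (T : cosyzygies R) d :
  cosyz T 0 = M -> fg_module M -> (forall i, (d < i)%N -> ext_zero P i M) ->
  injective_module (cosyz T d).
Proof.
move=> E fgM Z; apply: cosyz_injective => I hI.
apply: (bass hR hm _ _ hI (leqnn d)); rewrite ?E // => j dj.
by apply: (@ext_zero_lifts R m P); rewrite E; apply: Z.
Qed.

Lemma gorenstein_of_ext d : (forall i, (d < i)%N -> ext_zero P i R^o) -> gorenstein R.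
Proof.
move=> Z; have [T TE] := @cosyzygies_exist R R^o.
rewrite /gorenstein -TE; apply: (@cosyz_finite R T d).
exact: ext_zero_cosyz_injective TE (@ring_fg R) Z.
Qed.

End Gorenstein.

(** * Injectivity modulo a regular sequence *)

Section Modulo.
Context {R : comNzRingType} (T : cosyzygies R).
Implicit Types (t : seq R) (x : R).

Lemma smul_cons x t (a : R^o) : smul t a -> smul (x :: t) a.
Proof. by move=> ta; exists 0, a; rewrite scaler0 add0r. Qed.

Lemma smul_head x t : smul (x :: t) (x : R^o).
Proof.
exists 1, 0; rewrite addr0; split; first exact: sub0 (smul_submodule _ _).
by apply/esym/mulr1.
Qed.

Lemma killed_cons x t (M : lmodType R) (y : M) :
  killed (@smul R t R^o) y -> x *: y = 0 -> killed (@smul R (x :: t) R^o) y.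
Proof.
move=> ty xy _ [z [w [tw ->]]]; rewrite scalerDl (ty w tw) addr0.
by rewrite [x *: z]mulrC -scalerA xy scaler0.
Qed.

Lemma hull_divisible j x t (e : hull T j) : regular (x :: t) R^o ->
  killed (@smul R t R^o) e -> exists e', killed (@smul R t R^o) e' /\ x *: e' = e.
Proof.
move=> [_ tx] te; apply: injective_divide; first exact: hull_injective.
  exact: smul_submodule.
by move=> a; rewrite mulrC => /tx/te.
Qed.

(** Ext^i(R/(t), C_0) = 0 for i > |t|, as R/(t) has projective dimension |t|. *)
Lemma lifts_regular t : regular t R^o ->
  forall j, (size t <= j)%N -> lifts T j (@smul R t R^o).
Proof.
elim: t => [|x t IH] tx j.
  move=> _ c _; have [e eE] := cosyz_out_surj c.
  by exists e; split=> // a ->; rewrite scale0r.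
case: j => // j tj c tc.
have [|e0 [e0E e0t]] := IH tx.1 j.+1 (leqW tj) c; first by move=> a /smul_cons/tc.
have /cosyz_exact[y yE] : cosyz_out T j.+1 (x *: e0) = 0.
  by rewrite linearZZ e0E; apply/tc/smul_head.
have [|y' [y'E y't]] := IH tx.1 j tj y.
  move=> a ta; apply: (@cosyz_in_inj _ T j.+1).
  by rewrite linearZZ yE scalerA mulrC -scalerA e0t // scaler0 linear0.
have [y'' [y''t y''E]] := hull_divisible tx y't.
have out0 : cosyz_out T j.+1 (cosyz_in T j.+1 (cosyz_out T j y'')) = 0.
  by apply/cosyz_exact; exists (cosyz_out T j y'').
exists (e0 - cosyz_in T j.+1 (cosyz_out T j y'')); split.
  by rewrite linearB e0E out0 subr0.
apply: killed_cons => [a ta|].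
  by rewrite scalerBr e0t // sub0r -linearZZ -linearZZ y''t // !linear0.
apply/eqP; rewrite scalerBr subr_eq0 -yE -y'E -y''E; apply/eqP.
by rewrite linearZZ linearZZ.
Qed.

(** The graph of a map from the part of C_|t| killed by t onto C_0/tC_0, a
    composite of connecting homomorphisms. *)
Fixpoint residue t : cosyz T (size t) -> cosyz T 0 -> Prop :=
  match t return cosyz T (size t) -> cosyz T 0 -> Prop with
  | [::] => fun c n => c = n
  | x :: t' => fun c n => exists e y,
     [/\ killed (@smul R t' R^o) e, cosyz_out T (size t') e = c,
         x *: e = cosyz_in T (size t') y & residue y n]
  end.

Lemma residue_combination t a c c' n n' :
  @residue t c n -> @residue t c' n' -> @residue t (a *: c + c') (a *: n + n').
Proof.
elim: t c c' n n' => [|x t IH] c c' n n' /=; first by move=> -> ->.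
move=> [e [y [et <- xe yn]]] [e' [y' [e't <- xe' y'n']]].
exists (a *: e + e'), (a *: y + y'); split; last exact: IH.
- by move=> b tb; rewrite scalerDr scalerA mulrC -scalerA et // e't // scaler0 addr0.
- by rewrite linearP.
- by rewrite scalerDr scalerA mulrC -scalerA xe xe' linearP.
Qed.

Lemma residue_total t (c : cosyz T (size t)) :
  regular t R^o -> killed (@smul R t R^o) c -> exists n, residue c n.
Proof.
elim: t c => [|x t IH] c; first by exists c.
move=> tx tc; have [|e [eE et]] := lifts_regular tx.1 (leqnn _) (c := c).
  by move=> a /smul_cons/tc.
have /cosyz_exact[y yE] : cosyz_out T (size t) (x *: e) = 0.
  by rewrite linearZZ eE; apply/tc/smul_head.
have [|n yn] := IH y tx.1; last by exists n, e, y.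
move=> a ta; apply: (@cosyz_in_inj _ T (size t)).
by rewrite linearZZ yE scalerA mulrC -scalerA et // scaler0 linear0.
Qed.

Lemma residue_well_defined t n :
  regular t R^o -> @residue t 0 n -> smul t n.
Proof.
elim: t n => [|x t IH] n tx /=; first by move=> ->.
move=> [e [y [et /cosyz_exact[y' y'E] xe yn]]].
have [|n' y'n'] := @residue_total t y' tx.1.
  move=> a ta; apply: (@cosyz_in_inj _ T (size t)).
  by rewrite linearZZ y'E et // linear0.
have yE : y = x *: y'.
  by apply: (@cosyz_in_inj _ T (size t)); rewrite linearZZ y'E xe.
exists n', (n - x *: n'); split; last by rewrite addrC subrK.
apply: IH tx.1 _; have := residue_combination (- x) y'n' yn.
by rewrite yE !scaleNr addNr addrC.
Qed.

(** A linear section of the residue map modulo tM: as x is regular on M/tM, the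
    previous section into C_|t|, composed with C_|t| -> I_|t|, is x g for some
    g : M/tM -> I_|t|, and g induces M/(x, t)M -> C_(|t|+1). *)
Lemma residue_section t : regular t (cosyz T 0) ->
  exists s : {linear cosyz T 0 -> cosyz T (size t)},
    (forall n, smul t n -> s n = 0) /\ forall n, residue (s n) n.
Proof.
elim: t => [|x t IH] tx; first by exists idfun.
have [s [s0 sres]] := IH tx.1.
have ht := smul_submodule t (cosyz T 0).
have [||g gP] := @injective_extend R (hull T (size t)) (cosyz T 0)
  (fun p => exists n w, smul t w /\ p = (x *: n + w, cosyz_in T (size t) (s n)))
  (@hull_injective _ T _).
- split=> [|a _ _ [n [w [tw ->]]] [n' [w' [tw' ->]]]].
    exists 0, 0; rewrite !linear0 addr0; split=> //; exact: sub0.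
  exists (a *: n + n'), (a *: w + w'); split; first exact: ht.2.
  have -> : cosyz_in T (size t) (s (a *: n + n')) =
      a *: cosyz_in T (size t) (s n) + cosyz_in T (size t) (s n').
    by rewrite !linearP.
  rewrite pair_scaler pair_addr; congr (_, _).
  by rewrite !scalerDr !scalerA [a * x]mulrC addrACA.
- move=> e [n [w [tw [/esym/eqP + ->]]]]; rewrite addr_eq0 => /eqP xn.
  rewrite s0 ?linear0 //; apply: tx.2; rewrite xn; exact: subN.
have gx n : g (x *: n) = cosyz_in T (size t) (s n).
  by apply: gP; exists n, 0; rewrite addr0; split=> //; apply: sub0 ht.
have gw w : smul t w -> g w = 0.
  by move=> tw; apply: gP; exists 0, w; rewrite scaler0 add0r !linear0.
exists (cosyz_out T (size t) \o g); split=> [_ [n [w [tw ->]]]|n] /=.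
  rewrite linearD gx gw // addr0; apply/cosyz_exact; by exists (s n).
exists (g n), (s n); split=> //; last by rewrite -linearZZ gx.
by move=> a ta; rewrite -linearZZ gw //; apply: smul_ideal.
Qed.

End Modulo.

(** Baer's condition for M/tM as a module over R/(t). *)
Definition injective_modulo (R : comNzRingType) (t : seq R) (M : lmodType R) :=
  forall G : (R^o * M)%type -> Prop, submodule G ->
    (forall n, G (0, n) -> smul t n) -> (forall a, smul t a -> G (a, 0)) ->
    exists n0, forall a n, G (a, n) -> smul t (n - a *: n0).

(** M/tM is a retract of the part of C_|t| killed by t, which inherits
    injectivity from C_|t|. *)
Lemma injective_modulo_regular (R : comNzRingType) (T : cosyzygies R) (t : seq R) :
  regular t R^o -> regular t (cosyz T 0) -> injective_module (cosyz T (size t)) ->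
  injective_modulo t (cosyz T 0).
Proof.
move=> tR tM Cinj G hG Gf Gt.
have [s [s0 sres]] := residue_section tM.
have [||h hP] := @injective_extend R _ R^o
  (fun p => exists n, G (p.1, n) /\ p.2 = s n) Cinj.
- split=> [|r [a c] [a' c'] /= [n [Gn ->]] [n' [Gn' ->]]].
    by exists 0; split=> [|/=]; [exact: hG.1|rewrite linear0].
  by exists (r *: n + n'); rewrite linearP; split=> //; apply: (hG.2 _ _ _ Gn Gn').
- by move=> c /= [n [/Gf/s0 <- ->]].
have hE (a : R) : h a = a *: h 1 by rewrite -linearZZ [_ *: _]mulr1.
have [|n0 n0P] := residue_total tR (c := h 1).
  move=> a ta; rewrite -hE; apply: hP; exists 0; rewrite linear0.
  by split=> //; apply: Gt.
exists n0 => a n Gan; apply: (residue_well_defined (T := T) tR).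
have := residue_combination (- a : R) n0P (sres n).
rewrite !scaleNr -hE (hP a (s n)); last by exists n.
by rewrite addNr addrC.
Qed.

(** * The canonical module of a Gorenstein ring *)

Section Canonical.
Context {R : comNzRingType} (hR : noetherian R) (m : idealr R) (hm : local_ring m).
Implicit Types (t : seq R) (M : lmodType R).

Definition socle t M (y : M) := forall a, a \in m -> smul t (a *: y).

Lemma coefficient_maximal t M (y : M) a : ~ smul t y -> smul t (a *: y) -> a \in m.
Proof.
move=> ny ay; apply: contrapT => /negP/(local_unit hR hm)[b ba].
by apply: ny; rewrite -[y]scale1r -ba -scalerA; apply: subZ (smul_submodule _ _) ay.
Qed.

(** The element u embeds k into R/(t), and Ext^n(R/(t), R) = 0 for n > |t|. So if
    C_n is injective and n > |t|, then Ext^n(k, R) = 0, and C_(n-1) is injective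
    as well. *)
Lemma injective_dimension_depth (T : cosyzygies R) t n u :
  cosyz T 0 = R^o -> regular t R^o ->
  ~ smul t (u : R^o) -> socle t (u : R^o) -> injective_module (cosyz T n) ->
  injective_module (cosyz T (size t)).
Proof.
move=> TE tR nu mu; elim: n => [|n IH] Cinj.
  by elim: (size t) => // l; apply: next_injective.
have [nt|] := ltnP (size t) n.+1; last first.
  by move=> /subnK <-; elim: (_ - _)%N => // l; rewrite addSn; apply: next_injective.
apply: IH; apply: cosyz_injective => I hI.
apply: (bass hR hm _ _ hI (leqnn n)); first by rewrite TE; apply: ring_fg.
move=> j; rewrite leq_eqVlt => /orP[/eqP <-|nj]; last first.
  apply: lifts_injective; rewrite -(subnK nj).
  by elim: (j - _)%N => // l; rewrite addSn; apply: next_injective.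
move=> c mc; have [|c' [tc' c'E]] := injective_divide (b := u) (x := c) Cinj
    (smul_submodule t R^o).
  by move=> a /(coefficient_maximal nu)/mc.
have [e [eE te]] := lifts_regular tR nt tc'.
exists (u *: e); split; first by rewrite linearZZ eE.
by move=> a am; rewrite scalerA; apply/te/mu.
Qed.

(** Take a multiple b y outside tM whose annihilator p modulo tM is maximal; then
    p is a prime. If it were not m, then for x in m outside p the submodule N of
    M/tM killed by p would satisfy N = xN by injectivity, hence N = 0. *)
Lemma socle_essential t M (y : M) :
  fg_module M -> injective_modulo t M -> ~ smul t y ->
  exists b, ~ smul t (b *: y) /\ socle t (b *: y).
Proof.
move=> fgM Minj ny; have ht := smul_submodule t M.
pose ann (n : M) := fun a : R^o => smul t (a *: n).
have annS n : submodule (ann n).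
  split=> [|a b c]; rewrite /ann ?scale0r; first exact: sub0.
  by rewrite scalerDl -scalerA; apply: ht.2.
have [||_ [[b [nby ->]] bmax]] := @maximal_submodule R hR R^o
  (fun I => exists b, ~ smul t (b *: y) /\ I = ann (b *: y)) (ann y) (@ring_fg R).
- by move=> _ [b [_ ->]].
- by exists 1; rewrite scale1r.
exists b; split=> //; set w := b *: y in nby bmax *.
have prime a : ~ smul t (a *: w) -> forall c, smul t (c *: (a *: w)) -> smul t (c *: w).
  move=> aw c caw; apply: (bmax (ann (a *: w))) => //.
    by exists (a * b); rewrite -scalerA.
  by move=> c'; rewrite /ann => c'w; rewrite scalerA mulrC -scalerA; apply: subZ.
apply: contrapT => nsoc; have [x [xm nxw]] : exists x, x \in m /\ ~ smul t (x *: w).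
  apply: contrapT => nx; apply: nsoc => a am.
  by apply: contrapT => aw; apply: nx; exists a.
pose K (n : M) := forall a, ann w a -> smul t (a *: n).
have hK : submodule K.
  split=> [a _|r n n' Kn Kn' a aw]; first by rewrite scaler0; apply: sub0.
  by rewrite scalerDr scalerA mulrC -scalerA; apply: ht.2; [apply: Kn|apply: Kn'].
have [l lP] := submodule_fg hR fgM hK.
apply: nby; apply: (nakayama hR hm (K := K) ht (l := l)) => [n /lP ln|n nl|n Kn|//].
- by exists n; rewrite subrr; split=> //; apply: sub0.
- exact/lP/span_mem.
have [|||n0 n0P] := Minj (fun q => exists a c, [/\ ann w a, q.1 = a + c * x &
    smul t (q.2 - c *: n)]).
- split=> [|r [p1 p2] [p1' p2'] [a [c [wa /= q1 q2]]] [a' [c' [wa' /= q1' q2']]]].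
    exists 0, 0; split; [exact: sub0 (annS w)|by rewrite mul0r addr0|].
    by rewrite scale0r subr0; apply: sub0.
  exists (r *: a + a'), (r * c + c'); split; first exact: (annS w).2.
    by rewrite /= q1 q1' mulrDl scalerDr addrACA -mulrA.
  have := ht.2 r _ _ q2 q2'; rewrite scalerBr addrACA -opprD scalerA.
  by rewrite -scalerDl.
- move=> n' [a [c [wa /= /esym/eqP + q2]]]; rewrite addr_eq0 => /eqP aE.
  have cw : smul t (c *: w).
    apply: (prime x nxw); rewrite scalerA -[c * x]opprK -aE scaleNr; exact: subN.
  by have := subD ht q2 (Kn c cw); rewrite subrK.
- move=> a ta; exists a, 0; split; [exact: smul_ideal|by rewrite mul0r addr0|].
  by rewrite scale0r subr0; apply: sub0.
exists x, n0, (n - x *: n0); split=> //.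
- move=> a wa; have := n0P a 0 _; rewrite sub0r => h.
  rewrite -[_ *: _]opprK; apply: (subN ht); apply: h.
  exists a, 0; split=> //; first by rewrite mul0r addr0.
  by rewrite scale0r subr0; apply: sub0.
- apply: n0P; exists 0, 1; split; [exact: sub0 (annS w)|by rewrite mul1r add0r|].
  by rewrite scale1r subrr; apply: sub0.
- by rewrite addrC subrK.
Qed.

(** The map ru |-> rw is well defined modulo t: if ru lies in (t), then r is in
    m, which kills w. By injectivity it extends to R/(t), with 1 |-> z. *)
Lemma socle_map t M (u : R^o) (w : M) : injective_modulo t M ->
  ~ smul t u -> socle t w -> exists z, smul t (w - u *: z).
Proof.
move=> Minj nu mw; have ht := smul_submodule t M; have hu := smul_submodule t R^o.
have [|||z zP] := Minj (fun q => exists r : R, smul t (q.1 - r *: u) /\ smul t (q.2 - r *: w)).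
- split=> [|a [q1 q2] [q1' q2'] /= [r [h1 h2]] [r' [h1' h2']]].
    by exists 0; rewrite !scale0r !subr0; split; apply: sub0.
  exists (a * r + r'); split.
    by have := hu.2 a _ _ h1 h1'; rewrite scalerBr addrACA -opprD scalerA -scalerDl.
  by have := ht.2 a _ _ h2 h2'; rewrite scalerBr addrACA -opprD scalerA -scalerDl.
- move=> n [r [/= h1 h2]].
  have rm : r \in m.
    by apply: (coefficient_maximal nu); have := subN hu h1; rewrite sub0r opprK.
  by have := subD ht h2 (mw r rm); rewrite subrK.
- by move=> a ta; exists 0; rewrite /= !scale0r !subr0; split=> //; apply: sub0.
exists z; apply: zP; exists 1; rewrite /= !scale1r !subrr; split; exact: sub0.
Qed.

Section Comparison.
Context (M : lmodType R) (fgM : fg_module M) (t : seq R).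
Context (Rinj : injective_modulo t R^o) (Minj : injective_modulo t M).
Context (u : R^o) (mu : socle t u).
Context (w : M) (nw : ~ smul t w) (mw : socle t w).
Hypothesis socle_line : forall y z : M, socle t y -> socle t z ->
  exists a b, (a \notin m \/ b \notin m) /\ smul t (a *: y + b *: z).

Let ht := smul_submodule t M.
Let hu := smul_submodule t R^o.

(** The map r |-> rz carries u to w, which is nonzero, so u is not in its kernel.
    But u is a multiple of every nonzero element a of R/(t). *)
Lemma kernel_modulo (z : M) : smul t (w - u *: z) ->
  forall a : R^o, smul t (a *: z) -> smul t a.
Proof.
move=> uz a az; apply: contrapT => na.
have [r ru] := socle_map Rinj na mu.
apply: nw; rewrite -[w](subrK (u *: z)); apply: subD => //.
rewrite -[u](subrK (a *: r)) scalerDl; apply: subD => //; first exact: smul_ideal.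
have -> : (a *: r) *: z = r *: (a *: z) by rewrite scalerA mulrC.
exact: subZ.
Qed.

(** M/tM is generated by z: by injectivity of R/(t), any y can be corrected by
    a multiple of z to some y' with (Rz : y') = (0 : y') modulo t. A nonzero y'
    would have a nonzero multiple in the socle, which is the line of w = uz. *)
Lemma generator_modulo (z : M) : smul t (w - u *: z) ->
  forall y, exists r, smul t (y - r *: z).
Proof.
move=> uz y; have zI := kernel_modulo uz.
have [|||r rP] := Rinj (G := fun q => smul t (q.1 *: y - q.2 *: z)).
- split=> [|a [b c] [b' c'] /= h h']; first by rewrite !scale0r subrr; apply: sub0.
  have := ht.2 a _ _ h h'; rewrite scalerBr addrACA -opprD.
  by rewrite !scalerA -!scalerDl.
- by move=> c /=; rewrite scale0r sub0r => /(subN ht); rewrite opprK => /zI.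
- by move=> a ta /=; rewrite scale0r subr0; apply: smul_ideal.
exists r; apply: contrapT => ny.
have [b [nby sby]] := socle_essential fgM Minj ny.
have [a [c [ac awc]]] := socle_line mw sby.
have cm : c \notin m.
  apply/negP => cm; case: ac => [am|]; last by rewrite cm.
  case/negP: am; apply: (coefficient_maximal nw).
  by have := subB ht awc (sby c cm); rewrite addrK.
have [c' c'c] := local_unit hR hm cm.
pose r' := - (c' * a * u).
have byz : smul t (b *: (y - r *: z) - r' *: z).
  have := subD ht (subZ c' ht awc) (subZ (- (c' * a)) ht uz).
  move: (b *: (y - r *: z)) => Y; rewrite scalerDr !scalerA c'c scale1r scalerBr !scaleNr opprK.
  by rewrite scalerA addrACA subrr add0r opprK.
have : smul t ((b * r + r' : R^o) - b *: r).
  apply: rP; move: byz; rewrite scalerBr -addrA -opprD scalerA.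
  by rewrite -scalerDl.
have -> : (b * r + r' : R^o) - b *: r = r' by rewrite addrC addKr.
move=> r't.
apply: nby; rewrite -[_ *: _](subrK (r' *: z)); apply: subD => //.
exact: smul_ideal.
Qed.

End Comparison.

(** The last element of the sequence may be dropped from both conditions below
    by Nakayama's lemma; thus they descend from M/tM to M. *)
Lemma generator_lift M t (z : M) : fg_module M -> {subset t <= m} ->
  (forall y, exists r, smul t (y - r *: z)) -> forall y, exists r, y = r *: z.
Proof.
move=> fgM; elim: t => [|x t IH] tm gen.
  by move=> y; have [r /= /eqP] := gen y; rewrite subr_eq0 => /eqP; exists r.
apply: IH => [y yt|]; first by apply: tm; rewrite in_cons yt orbT.
have ht := smul_submodule t M; have [l lP] := fgM => y.
apply: (nakayama hR hm (K := fun _ => True) (l := l)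
  (L := fun y => exists r, smul t (y - r *: z))) => // [|{}y _|{}y _].
- split=> [|a y1 y2 [r h] [r' h']].
    by exists 0; rewrite scale0r subrr; apply: sub0.
  exists (a * r + r'); have := ht.2 a _ _ h h'.
  by rewrite scalerBr addrACA -opprD scalerA -scalerDl.
- by exists y; split=> //; exists 0; rewrite subrr scale0r subrr; apply: sub0.
have [r [v [v' [tv' e]]]] := gen y; exists x, v, (v' + r *: z); split=> //.
- exact/tm/mem_head.
- by exists r; rewrite addrK.
- by rewrite addrA -e subrK.
Qed.

Lemma kernel_lift M t (z : M) : {subset t <= m} -> regular t R^o -> regular t M ->
  (forall a : R^o, smul t (a *: z) -> smul t a) -> forall a, a *: z = 0 -> a = 0.
Proof.
elim: t => [_ _ _ K a /K //|x t IH] tm tR tM K.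
apply: IH tR.1 tM.1 _ => [y yt|]; first by apply: tm; rewrite in_cons yt orbT.
have ht := smul_submodule t M; have hR' := smul_submodule t R^o.
have hK : submodule (fun a : R^o => smul t (a *: z)).
  split=> [|a b c]; first by rewrite scale0r; apply: sub0.
  by rewrite scalerDl -scalerA; apply: ht.2.
have [l lP] := submodule_fg hR (@ring_fg R) hK.
apply: (nakayama hR hm hR' (l := l)) => [a /lP la|a al|a az].
- by exists a; rewrite subrr; split=> //; apply: sub0.
- exact/lP/span_mem.
have [|b [c [tc aE]]] := K a; first by exists 0, (a *: z); rewrite scaler0 add0r.
exists x, b, c; split=> //; first exact/tm/mem_head.
apply: tM.2; rewrite scalerA.
have -> : (x * b) *: z = a *: z - c *: z.
  by rewrite -scalerBl aE addrK.
by apply: subB => //; apply: smul_ideal.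
Qed.

End Canonical.

Section FreeModule.
Context {R : comNzRingType} (m : idealr R) (M : lmodType R) (z : M).
Hypothesis gen : forall y, exists r, y = r *: z.
Hypothesis free : forall r : R, r *: z = 0 -> r = 0.

Lemma row1_map : exists f : {linear 'rV[R]_1 -> M},
  (forall x, f x = x 0 0 *: z) /\ injective f.
Proof.
have [|f fE] := @bundle_linear R 'rV[R]_1 M (fun x => x 0 0 *: z).
  by move=> a x y; rewrite !mxE scalerDl scalerA.
exists f; split=> // x y; rewrite !fE => /eqP; rewrite -subr_eq0 -scalerBl.
move=> /eqP/free/eqP; rewrite subr_eq0 => /eqP xy.
by apply/rowP => j; rewrite !ord1.
Qed.

Lemma row1_surj (f : {linear 'rV[R]_1 -> M}) :
  (forall x, f x = x 0 0 *: z) -> forall y, exists x, f x = y.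
Proof.
by move=> fE y; have [r ->] := gen y; exists (const_mx r); rewrite fE mxE.
Qed.

Lemma cyclic_free_resolution : exists F : free_resolution M, minimal_resolution m F.
Proof.
have [f [fE fI]] := row1_map.
pose rk n := if n is 0 then 1%N else 0%N.
have flat0 (x : 'rV[R]_0) : x = 0 by apply/rowP => -[].
unshelve eexists (@FreeResolution R M rk f (fun n => \0) (row1_surj fE) _ _).
- move=> x; split=> [fx|[y <-]]; last exact: linear0.
  exists 0; apply: fI; rewrite fx; exact: linear0.
- by move=> n x; split=> // _; exists 0; rewrite [x]flat0.
- by move=> n x j; rewrite mxE idealr0.
Qed.

Lemma cyclic_free_summand : has_nonzero_free_summand M.
Proof.
have [f [fE fI]] := row1_map.
pose Z : lmodType R := 'rV[R]_0.
have Z0 (x : Z) : x = 0 by apply/rowP => -[].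
have [g gE] : exists g : {linear ('rV[R]_1 * Z)%type -> M}, forall x, g x = f x.1.
  by apply: bundle_linear => a x y; rewrite linearP.
have gI : injective g.
  move=> [x1 x2] [y1 y2]; rewrite !gE => /fI /= ->.
  by rewrite [x2]Z0 [y2]Z0.
have [|h hE] := @lift_injection R M M ('rV[R]_1 * Z)%type g idfun gI.
  by move=> y; have [x <-] := row1_surj fE y; exists (x, 0); rewrite gE.
exists 1%N, Z, h; split=> //; exists g => y; first exact: hE.
by apply: gI; rewrite hE.
Qed.

End FreeModule.

Section CanonicalGorenstein.
Context {R : comNzRingType} (hR : noetherian R) (m : idealr R) (hm : local_ring m).
Context (P : free_resolution (residue_field m)) (d : nat) (hd : depth m d).

Lemma ext_zero_pair (M N : lmodType R) i :
  ext_zero P i M -> ext_zero P i N -> ext_zero P i (M * N)%type.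
Proof.
move=> ZM ZN f fc.
have [p1 p1E] : exists p : {linear (M * N)%type -> M}, forall x, p x = x.1.
  exact: bundle_linear.
have [p2 p2E] : exists p : {linear (M * N)%type -> N}, forall x, p x = x.2.
  exact: bundle_linear.
have {ZM} := ZM (p1 \o f); have {ZN} := ZN (p2 \o f).
have c1 x : p1 (f (res_diff P i x)) = 0 by rewrite fc linear0.
have c2 x : p2 (f (res_diff P i x)) = 0 by rewrite fc linear0.
move=> /(_ c2) + /(_ c1); case: i f fc c1 c2 => [|i] f fc c1 c2 /=.
  move=> z2 z1 x; have := z1 x; have := z2 x; rewrite p1E p2E.
  by case: (f x) => [a b] /= -> ->.
move=> [g2 g2E] [g1 g1E].
have [|g gE] := @bundle_linear R _ (M * N)%type (fun x => (g1 x, g2 x)).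
  by move=> a x y; rewrite !linearP.
exists g => x; rewrite gE -g1E -g2E p1E p2E; exact: surjective_pairing.
Qed.

Lemma pair_fg (M N : lmodType R) :
  fg_module M -> fg_module N -> fg_module (M * N)%type.
Proof.
move=> [l1 l1P] [l2 l2P].
exists ([seq (x, 0) | x <- l1] ++ [seq (0, y) | y <- l2]) => -[x y].
have -> : (x, y) = (x, 0) + (0, y) :> (M * N)%type.
  by rewrite pair_addr addr0 add0r.
apply: span_cat.
  elim: (l1) x (l1P x) => [|g l IH] x /=; first by move->.
  move=> [a [s [ls ->]]]; exists a, (s, 0); split; first exact: IH.
  by rewrite pair_scaler pair_addr scaler0 addr0.
elim: (l2) y (l2P y) => [|g l IH] y /=; first by move->.
move=> [a [s [ls ->]]]; exists a, (0, s); split; first exact: IH.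
by rewrite pair_scaler pair_addr scaler0 addr0.
Qed.

(** The sequence t is chosen regular on R and on omega. Modulo t both become
    injective over R/(t), with essential socle; they are compared there, and the
    comparison is lifted. *)
Lemma canonical_free (omega : lmodType R) : gorenstein R -> fg_module omega ->
  (forall i, i <> d -> ext_zero P i omega) -> ~ ext_zero P d omega ->
  ext_rank_le1 P m d omega ->
  exists z : omega, (forall y, exists r, y = r *: z) /\ forall r : R, r *: z = 0 -> r = 0.
Proof.
move=> gor fgM Z nZ rk.
have Zlt i : (i < d)%N -> ext_zero P i omega.
  by move=> id; apply: Z => e; rewrite e ltnn in id.
have [||t [td tm /regular_pair[tR tM]]] :=
  @regular_exists R hR m hm P (R^o * omega)%type d.
- exact: pair_fg (@ring_fg R) fgM.
- by move=> i id; apply: ext_zero_pair; [exact: (ext_zero_ring hd)|exact: Zlt].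
have [u [nu mu]] := depth_socle hR hm hd td tm tR.
have [w [nw mw]] : exists w : omega, ~ smul t w /\ socle m t w.
  apply: contrapT => nw; apply: nZ.
  apply: (ext_zero_regular (n := 1) (@residue_killed _ m) tm tM); last by rewrite td.
  case=> // _; apply/ext_zero_socle => y.
  have [y' <-] := seq_proj_surj y => my; apply/seq_proj_eq0; apply: contrapT => ny.
  apply: nw; exists y'; split=> // a am; apply/seq_proj_eq0.
  by rewrite linearZZ my.
have line (y z : omega) : socle m t y -> socle m t z ->
    exists a b, (a \notin m \/ b \notin m) /\ smul t (a *: y + b *: z).
  move=> my mz.
  have rkQ : ext_rank_le1 P m 0 (seq_quotient omega t).
    by apply: ext_rank_quotient; rewrite ?add0n ?td.
  have [||a [b [ab e]]] := ext_rank_socle (y := seq_proj omega t y)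
    (z := seq_proj omega t z) rkQ.
  - by move=> a am; rewrite -linearZZ; apply/seq_proj_eq0/my.
  - by move=> a am; rewrite -linearZZ; apply/seq_proj_eq0/mz.
  exists a, b; split=> //; apply/seq_proj_eq0.
  by rewrite linearD !linearZZ.
have Rinj : injective_modulo t R^o.
  have [T [n [TE Cinj]]] := cosyzygies_of_resolution gor.
  have := injective_dimension_depth hR hm TE tR nu mu Cinj.
  rewrite -TE; apply: injective_modulo_regular => //.
  by rewrite TE.
have Minj : injective_modulo t omega.
  have [T TE] := cosyzygies_exist omega.
  have Cinj : injective_module (cosyz T (size t)).
    apply: (ext_zero_cosyz_injective hR hm (P := P) TE fgM) => i ti.
    by apply: Z => e; rewrite e td ltnn in ti.
  rewrite -TE; apply: injective_modulo_regular => //.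
  by rewrite TE.
have [z uz] := socle_map hR hm Minj nu mw.
exists z; split.
  apply: (generator_lift hR hm fgM tm).
  exact: (generator_modulo hR hm fgM Rinj Minj mu nw mw line uz).
apply: (kernel_lift hR hm tm tR tM).
exact: (kernel_modulo hR hm Rinj mu nw uz).
Qed.

End CanonicalGorenstein.

Lemma krull_dim_unique (R : comNzRingType) d e :
  krull_dim R d -> krull_dim R e -> d = e.
Proof.
move=> [cd maxd] [ce maxe]; apply/eqP; rewrite eqn_leq.
by rewrite maxe // maxd.
Qed.

Theorem corollary3p6 (R : comNzRingType) (m : idealr R) (omega : lmodType R)
    (hR : noetherian R) (hm : local_ring m) (hCM : cohen_macaulay m)
    (homega : canonical_module m omega) :
  gorenstein R <->
  exists (n : nat) (F : free_resolution omega),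
    minimal_resolution m F /\ has_nonzero_free_summand (syzygy F n).
Proof.
have [d [dimd hd]] := hCM.
have [/fin_gen_module fgM [e [dime [P PE]]]] := homega.
have ed := krull_dim_unique dime dimd; subst e.
have Z i : i <> d -> ext_zero P i omega.
  move=> /eqP/negPf id; apply: (residue_rank0_ext (m := m)).
  by have := PE i; rewrite id.
have [nZ rk] : ~ ext_zero P d omega /\ ext_rank_le1 P m d omega.
  by apply: residue_rank1_ext; have := PE d; rewrite eqxx.
split=> [gor|[[|n] [F [Fmin free]]]].
- have [z [gen free]] := canonical_free hR hm hd gor fgM Z nZ rk.
  have [F Fmin] := cyclic_free_resolution m gen free.
  by exists 0%N, F; split=> //; apply: cyclic_free_summand gen free.
- have [u [v vu]] := free_summand_retract free.
  apply: (gorenstein_of_ext hR hm (P := P) (d := d)) => i di.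
  apply: ext_zero_retract vu _; apply: Z => id; by rewrite id ltnn in di.
- case: (no_free_summand hR hm (P := P) hd (F := F) (n := n)) => // i id.
  by apply: Z => e; rewrite e ltnn in id.
Qed.
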